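(* Let $r>0$. There is a constant $C=C(B,r)>0$ such that for all $Q,\widetilde Q\in\mathbb{U}_{1,r}^{2\times2}$, $x\in[0,1]$, $\lambda\in\mathbb{C}$, $$|\Phi_Q(x,\lambda)-\Phi_{\widetilde Q}(x,\lambda)|\le C\,e^{2(b_2-b_1)|\operatorname{Im}\lambda|x}\sum_{j\ne k}\left(\sup_{s\in[0,x]}\left|\int_0^s\bigl(Q_{jk}(t)-\widetilde Q_{jk}(t)\bigr)e^{i(b_k-b_j)\lambda t}dt\right|+\|Q-\widetilde Q\|_1\sup_{s\in[0,x]}\left|\int_0^s\widetilde Q_{jk}(t)e^{i(b_k-b_j)\lambda t}dt\right|\right),$$ where the sum is over $(j,k)\in\{(1,2),(2,1)\}$. In particular, $$|\Phi_Q(x,\lambda)-\Phi_0(x,\lambda)|\le C\,e^{2(b_2-b_1)|\operatorname{Im}\lambda|x}\sum_{j\ne k}\sup_{s\in[0,x]}\left|\int_0^sQ_{jk}(t)e^{i(b_k-b_j)\lambda t}dt\right|,\qquad x\in[0,1],\ \lambda\in\mathbb{C}.$$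
   Context: Fix real numbers $b_1<0<b_2$ and $B=\operatorname{diag}(b_1,b_2)$. A potential matrix is $Q=\begin{pmatrix}0&Q_{12}\\Q_{21}&0\end{pmatrix}$ with entries in $L^1[0,1]$; $\|Q\|_1$ is its norm in $L^1([0,1];\mathbb{C}^{2\times 2})$, and $\mathbb{U}_{1,r}^{2\times2}$ is the set of potential matrices with $\|Q\|_1\le r$. $\Phi_Q(\cdot,\lambda)$ is the $2\times2$ fundamental matrix of $-iB^{-1}y'+Q(x)y=\lambda y$, $x\in[0,1]$, with $\Phi_Q(0,\lambda)=I_2$; $\Phi_0(x,\lambda)=\operatorname{diag}(e^{ib_1\lambda x},e^{ib_2\lambda x})$ is the one for $Q=0$. $|\cdot|$ is a fixed norm on $\mathbb{C}^{2\times2}$. *)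

(* Defs.v *)
From HB Require Import structures.
From mathcomp Require Import all_boot all_order all_algebra.
From mathcomp Require Import all_classical all_reals all_analysis.
From mathcomp Require Import complex.
Set Implicit Arguments.
Unset Strict Implicit.
Unset Printing Implicit Defensive.
Import Order.TTheory GRing.Theory Num.Theory.
Import numFieldNormedType.Exports.
Import ComplexField.Normc.
Local Open Scope classical_set_scope.
Local Open Scope ring_scope.
Local Open Scope complex_scope.

Local Notation Re := complex.Re.
Local Notation Im := complex.Im.

Section Complex.
Context {R : realType}.
Local Notation mu := (@lebesgue_measure R).
Implicit Types (f : R -> R[i]) (D : set R).

Definition cexp (z : R[i]) : R[i] :=
  (expR (Re z))%:C * (cos (Im z) +i* sin (Im z)).

Definition cintegrable D f : Prop :=
  mu.-integrable D (fun t => (Re (f t))%:E) /\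
  mu.-integrable D (fun t => (Im (f t))%:E).

Definition cintegral D f : R[i] :=
  (\int[mu]_(t in D) Re (f t)) +i* (\int[mu]_(t in D) Im (f t)).

Definition cderivable f (x : R) : Prop :=
  derivable (fun t => Re (f t)) x 1 /\ derivable (fun t => Im (f t)) x 1.

Definition cderive1 f (x : R) : R[i] :=
  derive1 (fun t => Re (f t)) x +i* derive1 (fun t => Im (f t)) x.

Definition abs_continuous (a b : R) f : Prop :=
  forall e : R, 0 < e -> exists2 d : R, 0 < d &
    forall (n : nat) (u v : 'I_n -> R),
      (forall i, [/\ a <= u i, u i <= v i & v i <= b]) ->
      trivIset setT (fun i => `]u i, v i[%classic) ->
      \sum_i (v i - u i) < d ->
      \sum_i normc (f (v i) - f (u i)) < e.

End Complex.

Section DiracSystem.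
Context {R : realType}.
Local Notation mu := (@lebesgue_measure R).
Implicit Types (N : 'M[R[i]]_2 -> R) (Q Y : R -> 'M[R[i]]_2).

Record is_norm N : Prop := IsNorm {
  norm_ge0 : forall A, 0 <= N A ;
  norm_eq0 : forall A, N A = 0 -> A = 0 ;
  norm_scale : forall (c : R[i]) A, N (c *: A) = normc c * N A ;
  norm_triangle : forall A A', N (A + A') <= N A + N A' }.

Definition bcoef (b1 b2 : R) (j : 'I_2) : R := if j == 0 then b1 else b2.

Definition Bmx (b1 b2 : R) : 'M[R[i]]_2 := diag_mx (\row_j (bcoef b1 b2 j)%:C).

(* Functions in L^1[0,1] are given by representatives defined on R; only their
   values on [0,1] matter. *)
Definition potential Q : Prop :=
  (forall x, 0 <= x <= 1 -> forall j, Q x j j = 0) /\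
  (forall j k, cintegrable `[0, 1]%classic (fun x => Q x j k)).

Definition L1norm N Q : R := \int[mu]_(x in `[0, 1]) N (Q x).

Definition U1r N (r : R) Q : Prop := potential Q /\ L1norm N Q <= r.

(* Caratheodory solution on [0,1] of -i B^-1 Y' + Q Y = lambda Y, Y(0) = I. *)
Definition fundamental_matrix (b1 b2 : R) Q (lambda : R[i]) Y : Prop :=
  [/\ Y 0 = 1%:M,
      forall j k, abs_continuous 0 1 (fun x => Y x j k) &
      {ae mu, forall x, 0 <= x <= 1 ->
        (forall j k, cderivable (fun t => Y t j k) x) /\
        (- 'i%C) *: (invmx (Bmx b1 b2) *m
                   \matrix_(j, k) cderive1 (fun t => Y t j k) x)
          + Q x *m Y x = lambda *: Y x}].

Definition Phi0 (b1 b2 : R) (x : R) (lambda : R[i]) : 'M[R[i]]_2 :=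
  diag_mx (\row_j cexp ('i%C * (bcoef b1 b2 j)%:C * lambda * x%:C)).

Definition supfourier (b1 b2 : R) (j k : 'I_2) (q : R -> R[i])
    (lambda : R[i]) (x : R) : R :=
  sup [set normc (cintegral `[0, s]%classic (fun t => q t *
         cexp ('i%C * (bcoef b1 b2 k - bcoef b1 b2 j)%:C * lambda * t%:C)))
      | s in `[0, x]%classic].

End DiracSystem.

(* Main.v *)
Require Import Defs.
From HB Require Import structures.
From mathcomp Require Import all_boot all_order all_algebra.
From mathcomp Require Import all_classical all_reals all_analysis.
From mathcomp Require Import complex measurable_realfun.
From mathcomp Require Import ring lra.
Import Order.TTheory GRing.Theory Num.Theory.
Local Open Scope ring_scope.

(** Put b = b2 - b1, eta = Im lambda, and let y, z be the same column of Phi_Q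
    and Phi_Qt, so that y_j' = i b_j (lambda y_j - Q_jk y_k) and likewise for z
    with Qt.  The difference y - z solves the system with potential Q and the
    extra forcing -i b_j (Q - Qt)_jk z_k.  That forcing is not small in L^1;
    only the oscillatory integrals
      P_jk(s) = int_0^s (Q - Qt)_jk(t) e^{i (b_k - b_j) lambda t} dt
    are.  Integration by parts is encoded by a corrected difference,
      E_j = y_j - z_j + i b_j e^{i (b_j - b_k) lambda x} P_jk z_k,
    which again solves the system with potential Q, but with a forcing in which
    P_jk and P_kj appear undifferentiated, multiplied by entries of Q, Qt and by
    z ([corrected_difference_deriv]).

    An energy estimate for |E_1|^2 + |E_2|^2 then concludes
    ([energy_estimate], [column_comparison]).  Since |b_j| <= b, each solution
    grows at most like e^{b |eta| x}, and the correcting exponential is bounded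
    by the same quantity, which together give e^{2 b |eta| x}.  The remaining
    constants involve the potentials only through the integrals of the moduli
    of their entries, and those are at most a multiple of r because all norms on
    the 2 x 2 matrices are equivalent ([is_norm_upper], [is_norm_lower]).  The
    outcome ([dirac_comparison]) bounds Phi_Q - Phi_Qt by the suprema of the
    |P_jk|, and the other terms on the right-hand side are nonnegative.  Phi_0 solves the system with zero potential, so the second
    inequality is the case Qt = 0.

    The solutions are only absolutely continuous and solve the system almost
    everywhere, so the energy estimate needs a Gronwall inequality in that
    setting ([ac_gronwall]).  It reduces to one fact of real analysis: an
    absolutely continuous function whose derivative is almost everywhere
    nonpositive does not increase ([ac01_nonincreasing]).  Everything else is
    the calculus of pairs (f, g) with f absolutely continuous and f' = g almost
    everywhere ([ac_deriv], [cac_deriv]), to which the indefinite integrals of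
    integrable functions belong ([ac_deriv_Rintegral]). *)

Section ComparisonOfSolutions.
Local Set Implicit Arguments.
Local Unset Strict Implicit.
Local Unset Printing Implicit Defensive.
Import numFieldNormedType.Exports.
Import ComplexField.Normc.
Local Open Scope classical_set_scope.
Local Open Scope complex_scope.
Local Notation Re := complex.Re.
Local Notation Im := complex.Im.

(** * Absolutely continuous functions with nonpositive derivative *)

Section AbsolutelyContinuous.
Context {R : realType}.
Local Notation mu := (@lebesgue_measure R).

Definition interval_family (a b : R) n (u v : 'I_n -> R) : Prop :=
  (forall i, [/\ a <= u i, u i <= v i & v i <= b]) /\
  trivIset setT (fun i => `]u i, v i[%classic).

Definition ac01 (f : R -> R) : Prop :=
  forall e : R, 0 < e -> exists2 d : R, 0 < d &
    forall (n : nat) (u v : 'I_n -> R), interval_family 0 1 u v ->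
      \sum_i (v i - u i) < d -> \sum_i `|f (v i) - f (u i)| < e.

Lemma measure_interval_family (a b : R) n (u v : 'I_n -> R) :
  interval_family a b u v ->
  mu (\big[setU/set0]_(i < n) `]u i, v i[%classic) = (\sum_i (v i - u i))%:E.
Proof.
move=> [uv tI]; rewrite measure_bigsetU_ord//.
rewrite -sumEFin; apply: eq_bigr => i _.
have [_ uvi _] := uv i.
rewrite -[LHS]/(mu `]u i, v i[%classic) lebesgue_measure_itv/= lte_fin.
by case: ltgtP uvi => // ->; rewrite subrr.
Qed.

Lemma measure_interval_family_le (a b : R) n (u v : 'I_n -> R) (U : set R) :
  interval_family a b u v -> measurable U ->
  (forall i, `]u i, v i[ `<=` U) ->
  ((\sum_i (v i - u i))%:E <= mu U)%E.
Proof.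
move=> uv mU sU; rewrite -(measure_interval_family uv).
apply: le_measure; rewrite ?inE//; first exact: bigsetU_measurable.
by rewrite -bigcup_seq => x [i _]; exact: sU.
Qed.

Lemma is_derive_eps (f : R -> R) (x l : R) :
  is_derive x (1 : R) f l -> forall e, 0 < e ->
  exists2 d, 0 < d & forall y, `|y - x| < d ->
    `|f y - f x - l * (y - x)| <= e * `|y - x|.
Proof.
move=> [df dl] e e0.
have : h^-1 *: ((f \o shift x) (h *: 1) - f x) @[h --> 0^'] --> l by rewrite -dl.
move/cvgrPdist_lt => /(_ _ e0) [d /= d0 H]; exists d => // y yd.
have [->|yx] := eqVneq y x; first by rewrite !subrr mulr0 subrr normr0 mulr0.
have yx0 : y - x != 0 by rewrite subr_eq0.
have := H (y - x); rewrite /ball_/= sub0r normrN => /(_ yd yx0).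
rewrite /shift/= [_%:A]mulr1 subrK => /ltW.
rewrite distrC -(ler_pM2r (_ : 0 < `|y - x|)) ?normr_gt0// -normrM mulrBl.
by rewrite /GRing.scale/= mulrAC mulVf// mul1r.
Qed.

(** Straddling the base point is what makes the estimate hold for u and v
    jointly: the increment is the sum of the two one-sided increments at x. *)
Lemma is_derive_le0_straddle (f : R -> R) (x l : R) :
  is_derive x (1 : R) f l -> l <= 0 ->
  forall e, 0 < e -> exists2 d, 0 < d & forall u v, x - d < u -> u <= x ->
    x <= v -> v < x + d -> f v - f u <= e * (v - u).
Proof.
move=> fl l0 e e0; have [d d0 H] := is_derive_eps fl e0.
exists d => // u v du ux xv vd.
have {}H1 : f v - f x - l * (v - x) <= e * (v - x).
  rewrite -[X in e * X]ger0_norm ?subr_ge0//; apply: le_trans (ler_norm _) (H _ _).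
  by rewrite ger0_norm ?subr_ge0//; lra.
have {}H2 : - (f u - f x - l * (u - x)) <= e * (x - u).
  rewrite -[X in e * X]ger0_norm ?subr_ge0// distrC.
  apply: le_trans (ler_norm _) _; rewrite normrN; apply: (H _ _).
  by rewrite distrC ger0_norm ?subr_ge0//; lra.
have : l * (v - u) <= 0 by rewrite mulr_le0_ge0// subr_ge0 (le_trans ux).
by nra.
Qed.

(** The invariant of the covering argument: over [a, x], the increase of h
    beyond slope e is carried by finitely many disjoint intervals inside U. *)
Definition increment_bound (h : R -> R) (U : set R) (e a x : R) : Prop :=
  exists n (u v : 'I_n -> R), [/\ interval_family a x u v,
    forall i, `]u i, v i[ `<=` U &
    h x - h a <= e * (x - a) + \sum_i `|h (v i) - h (u i)|].

Lemma increment_bound_step (h : R -> R) (U : set R) (e a x y : R) :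
  0 <= e -> increment_bound h U e a x -> a <= x -> x <= y ->
  (h y - h x <= e * (y - x) \/ `]x, y[ `<=` U) -> increment_bound h U e a y.
Proof.
move=> e0 [n [u [v [[uv tI] sU hx]]]] ax xy [hxy|xyU].
  exists n, u, v; split => //; last by lra.
  by split=> // i; have [? ? vx] := uv i; split=> //; exact: le_trans vx xy.
pose ext (w : 'I_n -> R) (z : R) (i : 'I_n.+1) := oapp w z (unlift ord_max i).
have extm w z : ext w z ord_max = z by rewrite /ext unlift_none.
have extl w z i : ext w z (lift ord_max i) = w i by rewrite /ext liftK.
exists n.+1, (ext u x), (ext v y); split.
- split=> [i|].
    case: (unliftP ord_max i) => [j|] ->; rewrite ?extm ?extl//.
    by have [? ? vx] := uv j; split=> //; exact: le_trans vx xy.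
  move=> i j _ _.
  case: (unliftP ord_max i) => [i'|] ->; case: (unliftP ord_max j) => [j'|] ->;
    rewrite ?extm ?extl//.
  + by move=> ij; rewrite (tI _ _ I I ij).
  + have [_ _ vx] := uv i'.
    by move=> [z/= []]; rewrite !in_itv/= => /andP[_ zv] /andP[xz _]; exfalso; lra.
  + have [_ _ vx] := uv j'.
    by move=> [z/= []]; rewrite !in_itv/= => /andP[xz _] /andP[_ zv]; exfalso; lra.
- by move=> i; case: (unliftP ord_max i) => [j|] ->; rewrite ?extm ?extl.
- rewrite big_ord_recr/=.
  rewrite !extm.
  under eq_bigr => i _.
    rewrite (_ : widen_ord _ i = lift ord_max i); last first.
      by apply: val_inj; rewrite /= /bump leqNgt ltn_ord.
    rewrite !extl; over.
  have exy : e * (x - a) <= e * (y - a) by rewrite ler_wpM2l// lerD2r.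
  by have := ler_norm (h y - h x); move: hx exy; rewrite /=; lra.
Qed.

(** Cousin's lemma for the gauge d.  The supremum c of the good endpoints is
    straddled by one step from a good endpoint just left of it to a point just
    right of it, so c can only be b. *)
Lemma increment_bound_segment (h : R -> R) (U : set R) (e b : R) : 0 <= b -> 0 < e ->
  (forall c, 0 <= c <= b -> exists2 d, 0 < d & forall u v, c - d < u -> u <= c ->
    c <= v -> v < c + d -> h v - h u <= e * (v - u) \/ `]u, v[ `<=` U) ->
  increment_bound h U e 0 b.
Proof.
move=> b0 e0 gauge.
pose S := [set x | 0 <= x <= b /\ increment_bound h U e 0 x].
have S0 : S 0.
  split; first by rewrite lexx b0.
  exists 0%N, (fun=> 0), (fun=> 0); split; first by split=> [[]|[]].
    by case.
  by rewrite big_ord0 !subrr mulr0 addr0.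
have hS : has_sup S by split; [exists 0 | exists b => x [/andP[]]].
pose c := sup S.
have cub x : S x -> x <= c by move=> Sx; apply: ub_le_sup => //; exact: hS.2.
have c0 : 0 <= c by exact: cub.
have cb : c <= b by apply: ge_sup; [exists 0|move=> x [/andP[]]].
have [d d0 H] := gauge c (introT andP (conj c0 cb)).
have [x [/andP[x0 xb] Px] cx] := sup_adherent d0 hS.
have xc : x <= c by apply: cub; split=> //; rewrite x0.
pose y := Num.min b (c + d / 2).
have cy : c <= y by rewrite /y le_min cb; lra.
have yb : y <= b by rewrite /y ge_min lexx.
have yd : y < c + d by rewrite /y gt_min; apply/orP; right; lra.
have Py : increment_bound h U e 0 y.
  by apply: increment_bound_step (ltW e0) Px x0 (le_trans xc cy) _; exact: H.
have yc : y <= c by apply: cub; split=> //; rewrite yb (le_trans c0).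
suff -> : b = y by [].
by move: cy yc; rewrite /y /Num.min; case: ifP => // _; lra.
Qed.

(** The exceptional null set is enclosed in an open set U of small measure.  At
    an exceptional point small steps stay inside U, and absolute continuity
    bounds the total variation of h over disjoint intervals in U; at any other
    point the derivative bounds small steps. *)
Lemma ac01_nonincreasing (h g : R -> R) (b : R) : 0 <= b <= 1 -> ac01 h ->
  {ae mu, forall x, 0 <= x <= b -> is_derive x (1:R) h (g x) /\ g x <= 0} ->
  h b <= h 0.
Proof.
move=> /andP[b0 b1] ach [A [mA A0 sA]].
apply/ler_addgt0Pr => e e0.
have e20 : 0 < e / 2 by rewrite divr_gt0.
have [d d0 Hd] := ach _ e20.
have [|U [oU AU mUA]] := lebesgue_regularity_outer mA _ d0.
  by rewrite [ltLHS]A0 ltry.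
have mU : measurable U by exact: open_measurable.
have muU : (mu U < d%:E)%E.
  have -> : U = A `|` (U `\` A) by rewrite setDUK.
  apply: le_lt_trans (measureU2 _ _ _) _ => //; first exact: measurableD.
  by rewrite [X in (X + _)%E]A0 add0e.
have [|n [u [v [uv sU hb]]]] := @increment_bound_segment h U (e / 2) b b0 e20.
  move=> c c01.
  have [Ac|nAc] := pselect (A c).
    have [d1/= d10 Hd1] : \forall t \near c, U t.
      by apply: open_nbhs_nbhs; split=> //; exact: AU.
    exists d1 => // x y cx xc cy yc; right => z/=; rewrite in_itv/= => /andP[xz zy].
    by apply: Hd1; rewrite /ball_/= ltr_norml; lra.
  have [dh g0] : is_derive c (1:R) h (g c) /\ g c <= 0.
    by apply: contrapT => nH; apply: nAc; apply: sA => /= /(_ c01).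
  have [d1 d10 Hd1] := is_derive_le0_straddle dh g0 e20.
  by exists d1 => // x y ? ? ? ?; left; exact: Hd1.
have uv1 : interval_family 0 1 u v.
  split; last exact: uv.2.
  by move=> i; have [? ? ?] := uv.1 i; split=> //; lra.
have len : \sum_i (v i - u i) < d.
  rewrite -lte_fin; apply: le_lt_trans muU.
  exact: measure_interval_family_le uv1 _ _.
have := Hd n u v uv1 len; move: hb; nra.
Qed.

End AbsolutelyContinuous.

(** * Calculus of absolutely continuous functions *)

Section AcDeriv.
Context {R : realType}.
Local Notation mu := (@lebesgue_measure R).
Implicit Types (f g : R -> R).

(** Absolutely continuous on [0, 1] with almost everywhere derivative g.  The
    derivative is kept as data because all differential inequalities below are
    pointwise computations with it. *)
Definition ac_deriv f g : Prop :=
  ac01 f /\ {ae mu, forall x : R, 0 <= x <= 1 -> is_derive x (1 : R) f (g x)}.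

Lemma ae_imply (P Q : R -> Prop) : (forall x, P x -> Q x) ->
  {ae mu, forall x, P x} -> {ae mu, forall x, Q x}.
Proof.
by move=> PQ; apply: filterS; first exact: (ae_filter_ringOfSetsType mu).
Qed.

Lemma ae_imply2 (P1 P2 Q : R -> Prop) : (forall x, P1 x -> P2 x -> Q x) ->
  {ae mu, forall x, P1 x} -> {ae mu, forall x, P2 x} -> {ae mu, forall x, Q x}.
Proof.
by move=> PQ; apply: filterS2; first exact: (ae_filter_ringOfSetsType mu).
Qed.

(** Sums, products and Lipschitz images of absolutely continuous functions all
    have increments controlled by those of the given functions. *)
Lemma ac01_dominated f1 f2 f (L : R) : ac01 f1 -> ac01 f2 ->
  (forall u v : R, 0 <= u -> u <= v -> v <= 1 ->
    `|f v - f u| <= L * (`|f1 v - f1 u| + `|f2 v - f2 u|)) -> ac01 f.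
Proof.
move=> ac1 ac2 H e e0.
pose M := 1 + `|L|.
have M0 : 0 < M by rewrite /M ltr_pwDl.
have LM : L <= M by rewrite /M; have := ler_norm L; lra.
have e20 : 0 < e / (2 * M) by rewrite divr_gt0// mulr_gt0.
have [d1 d10 H1] := ac1 _ e20; have [d2 d20 H2] := ac2 _ e20.
exists (Num.min d1 d2); first by rewrite lt_min d10.
move=> n u v uv; rewrite lt_min => /andP[ud1 ud2].
have {}H1 := H1 n u v uv ud1; have {}H2 := H2 n u v uv ud2.
apply: (@le_lt_trans _ _ (M * (\sum_i `|f1 (v i) - f1 (u i)| +
                               \sum_i `|f2 (v i) - f2 (u i)|))).
  rewrite -big_split/= mulr_sumr; apply: ler_sum => i _.
  have [? ? ?] := uv.1 i; apply: le_trans (H _ _ _ _ _) _ => //.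
  by rewrite ler_wpM2r// addr_ge0.
have -> : e = M * (e / (2 * M) + e / (2 * M)) by field; rewrite gt_eqF.
by rewrite ltr_pM2l// ltrD.
Qed.

(** Steps of length at most d / 2 change f by less than 1, and boundedly many of
    them reach every point of [0, 1]. *)
Lemma ac01_bounded f : ac01 f -> exists2 M : R, 0 < M &
  forall x : R, 0 <= x <= 1 -> `|f x| <= M.
Proof.
move=> acf; have [d d0 H] := acf 1 ltr01.
pose s := d / 2.
have s0 : 0 < s by rewrite divr_gt0.
have step u v : 0 <= u -> u <= v -> v <= 1 -> v - u <= s -> `|f v - f u| < 1.
  move=> u0 uv v1 vus.
  have := H 1%N (fun=> u) (fun=> v); rewrite !big_ord1; apply.
    by split=> // i j _ _ _; rewrite !ord1.
  by apply: le_lt_trans vus _; rewrite /s; lra.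
have claim k : forall x : R, 0 <= x <= 1 -> x <= k%:R * s -> `|f x| <= `|f 0| + k%:R.
  elim: k => [|k IH] x /andP[x0 x1].
    by rewrite mul0r => x0'; rewrite (_ : x = 0) ?addr0//; lra.
  rewrite -natr1 mulrDl mul1r => xk.
  have [xs|xs] := leP x s.
    have := step 0 x (lexx _) x0 x1; rewrite subr0 => /(_ xs) f0x.
    have := ler_normD (f x - f 0) (f 0); rewrite subrK.
    by have : 0 <= k%:R :> R by []; lra.
  have /IH : 0 <= x - s <= 1 by lra.
  have /[swap] /[apply] : x - s <= k%:R * s by lra.
  have := step (x - s) x; have := ler_normD (f x - f (x - s)) (f (x - s)).
  rewrite subrK => ? /(_ _ _ x1) h; have {}h := h ltac:(lra) ltac:(lra) ltac:(lra).
  by lra.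
pose k := Num.bound s^-1.
exists (`|f 0| + k%:R + 1); first by rewrite ltr_wpDl// addr_ge0.
move=> x x01; apply: le_trans (claim k x x01 _) _; last by rewrite lerDl.
case/andP: x01 => _ x1; apply: (le_trans x1).
rewrite -ler_pdivrMr// mul1r; apply: ltW; apply: archi_boundP.
by rewrite invr_ge0 ltW.
Qed.

Lemma ac01_id : ac01 (@id R).
Proof.
move=> e e0; exists e => // n u v uv; apply: le_lt_trans.
apply: ler_sum => i _; have [_ ? _] := uv.1 i.
by rewrite ger0_norm ?subr_ge0.
Qed.

Lemma ac01_cst (c : R) : ac01 (cst c).
Proof.
apply: (ac01_dominated (L := 0) ac01_id ac01_id) => u v _ _ _.
by rewrite subrr normr0 mul0r.
Qed.

Lemma ac01D f1 f2 : ac01 f1 -> ac01 f2 -> ac01 (fun x => f1 x + f2 x).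
Proof.
move=> a1 a2; apply: (ac01_dominated (L := 1) a1 a2) => u v _ _ _.
by rewrite mul1r opprD addrACA; exact: ler_normD.
Qed.

Lemma ac01M f1 f2 : ac01 f1 -> ac01 f2 -> ac01 (fun x => f1 x * f2 x).
Proof.
move=> a1 a2; have [M1 M10 b1] := ac01_bounded a1.
have [M2 M20 b2] := ac01_bounded a2.
apply: (ac01_dominated (L := M1 + M2) a1 a2) => u v u0 uv v1.
have -> : f1 v * f2 v - f1 u * f2 u =
  f1 v * (f2 v - f2 u) + (f1 v - f1 u) * f2 u by ring.
apply: le_trans (ler_normD _ _) _; rewrite !normrM.
have := b1 v; have := b2 u.
have -> : 0 <= v <= 1 by lra.
have -> : 0 <= u <= 1 by lra.
move=> /(_ isT) h2 /(_ isT) h1.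
have := normr_ge0 (f2 v - f2 u); have := normr_ge0 (f1 v - f1 u).
move: `|f2 v - f2 u| `|f1 v - f1 u| => p q p0 q0.
have := ler_wpM2r p0 h1; have := ler_wpM2l q0 h2; nra.
Qed.

Lemma ae_neq (c : R) : {ae mu, forall x, x != c}.
Proof.
exists [set c]; split => //; first exact: lebesgue_measure_set1.
by move=> x /= /negP; rewrite negbK => /eqP.
Qed.

(** Differentiability at the endpoints of [0, 1] involves values outside the
    interval; the endpoints are discarded as a null set. *)
Lemma ac_deriv_eq f g f' g' : (forall x : R, 0 <= x <= 1 -> f x = f' x) ->
  (forall x : R, 0 <= x <= 1 -> g x = g' x) -> ac_deriv f g -> ac_deriv f' g'.
Proof.
move=> ff' gg' [acf dfg]; split.
  apply: (ac01_dominated (L := 1) acf acf) => u v u0 uv v1.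
  by rewrite -!ff' ?mul1r ?lerDl//; lra.
have := ae_imply2 (fun x => @conj _ _) (ae_neq 0) (ae_neq 1).
apply: ae_imply2 dfg => x H [x0 x1] x01.
rewrite -gg'//; apply: near_eq_is_derive (H x01).
have : x \in `]0, 1[%R by rewrite in_itv/= !lt_neqAle eq_sym x0 x1.
move=> /near_in_itvoo; apply: filterS => t; rewrite in_itv/= => /andP[t0 t1].
by apply: ff'; rewrite !ltW.
Qed.

Lemma ac_deriv_cst (c : R) : ac_deriv (cst c) (cst 0).
Proof. by split; [exact: ac01_cst|apply: aeW => x _; exact: is_derive_cst]. Qed.

Lemma ac_deriv_id : ac_deriv id (cst 1).
Proof. by split; [exact: ac01_id|apply: aeW => x _; exact: is_derive_id]. Qed.

Lemma ac_derivD f1 f2 g1 g2 : ac_deriv f1 g1 -> ac_deriv f2 g2 ->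
  ac_deriv (fun x => f1 x + f2 x) (fun x => g1 x + g2 x).
Proof.
move=> [a1 d1] [a2 d2]; split; first exact: ac01D.
by apply: ae_imply2 d1 d2 => x h1 h2 x01; apply: is_deriveD; auto.
Qed.

Lemma ac_derivM f1 f2 g1 g2 : ac_deriv f1 g1 -> ac_deriv f2 g2 ->
  ac_deriv (fun x => f1 x * f2 x) (fun x => g1 x * f2 x + f1 x * g2 x).
Proof.
move=> [a1 d1] [a2 d2]; split; first exact: ac01M.
apply: ae_imply2 d1 d2 => x h1 h2 x01.
have := is_deriveM (h1 x01) (h2 x01).
by rewrite (_ : _ + _ = g1 x * f2 x + f1 x * g2 x)// addrC [f2 x *: _]mulrC.
Qed.

Lemma ac_derivN f g : ac_deriv f g ->
  ac_deriv (fun x => - f x) (fun x => - g x).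
Proof.
move=> /(ac_derivM (ac_deriv_cst (-1))); apply: ac_deriv_eq => x _ /=.
- by rewrite mulN1r.
- by rewrite mul0r add0r mulN1r.
Qed.

(** A locally bounded derivative makes phi Lipschitz on the bounded range of
    f. *)
Lemma ac_deriv_comp (phi phi' : R -> R) f g :
  (forall x, is_derive x (1 : R) phi (phi' x)) ->
  (forall M : R, exists L : R, forall x, `|x| <= M -> `|phi' x| <= L) ->
  ac_deriv f g -> ac_deriv (fun x => phi (f x)) (fun x => phi' (f x) * g x).
Proof.
move=> dphi bphi [af df]; have [M M0 bf] := ac01_bounded af.
have [L HL] := bphi M.
have lip x y : x <= y -> `|x| <= M -> `|y| <= M ->
    `|phi y - phi x| <= L * `|y - x|.
  move=> xy xM yM.
  have [|c] := @MVT_segment R phi phi' x y xy (fun t _ => dphi t).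
    apply: derivable_within_continuous => t _.
    by have [] := dphi t.
  rewrite in_itv/= => /andP[xc cy] ->; rewrite normrM ler_wpM2r// HL//.
  by rewrite ler_norml; move: xM yM; rewrite !ler_norml; lra.
split.
  apply: (ac01_dominated (L := L) af af) => u v u0 uv v1.
  have bu : `|f u| <= M by apply: bf; lra.
  have bv : `|f v| <= M by apply: bf; lra.
  have L0 : 0 <= L by apply: le_trans (HL (f u) bu).
  apply: (@le_trans _ _ (L * `|f v - f u|)); last by rewrite ler_wpM2l// lerDl.
  have [h|h] := leP (f u) (f v); first exact: lip.
  by rewrite distrC [X in L * X]distrC lip// ltW.
by apply: ae_imply df => x h x01; apply: is_derive1_comp; exact: h.
Qed.

Lemma ac_deriv_expR f g : ac_deriv f g ->
  ac_deriv (fun x => expR (f x)) (fun x => expR (f x) * g x).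
Proof.
apply: ac_deriv_comp => M; exists (expR M) => x xM.
by rewrite ger0_norm ?expR_ge0// ler_expR (le_trans (ler_norm _)).
Qed.

Lemma ac_deriv_cos f g : ac_deriv f g ->
  ac_deriv (fun x => cos (f x)) (fun x => - sin (f x) * g x).
Proof.
apply: ac_deriv_comp => M; exists 1 => x _.
by rewrite normrN ler_norml sin_geN1 sin_le1.
Qed.

Lemma ac_deriv_sin f g : ac_deriv f g ->
  ac_deriv (fun x => sin (f x)) (fun x => cos (f x) * g x).
Proof.
apply: ac_deriv_comp => M; exists 1 => x _.
by rewrite ler_norml cos_geN1 cos_le1.
Qed.

End AcDeriv.

(** * Indefinite integrals and the Gronwall inequality *)

Section IndefiniteIntegral.
Context {R : realType}.
Local Notation mu := (@lebesgue_measure R).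
Implicit Types (k : R -> R).

(** Absolute continuity of the integral, applied to the union of the intervals
    of the family. *)
Lemma ac01_Rintegral k : mu.-integrable `[0, 1] (EFin \o k) ->
  ac01 (fun x => \int[mu]_(t in `[0, x]) k t).
Proof.
move=> ik e e0.
pose k0 := k \_ `[0, 1].
have ik0 : mu.-integrable setT (EFin \o k0).
  by rewrite /k0 -restrict_EFin -integrable_mkcond.
have [d [d0 H]] := integral_normr_continuous ik0 e0.
exists d => // n u v uv len.
have subI i : `]u i, v i[ `<=` `[0, 1]%classic.
  have [? ? ?] := uv.1 i.
  by move=> z/=; rewrite !in_itv/=; lra.
have inc i : `|\int[mu]_(t in `[0, v i]) k t - \int[mu]_(t in `[0, u i]) k t| <=
    \int[mu]_(t in `]u i, v i[) `|k0 t|.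
  have [u0 uvi v1] := uv.1 i.
  have ikS (A : set R) : measurable A -> A `<=` `[0, 1] ->
      mu.-integrable A (EFin \o k).
    by move=> mA sA; apply: integrableS ik.
  rewrite Rintegral_itvB ?bnd_simp//; last first.
    by apply: ikS => // z/=; rewrite !in_itv/=; lra.
  rewrite -Rintegral_itv_bndo_bndc; last exact: ikS.
  apply: le_trans (le_normr_Rintegral _ _) _ => //; first exact: ikS.
  rewrite le_eqVlt; apply/orP; left; apply/eqP; apply: eq_Rintegral => t tuv.
  by rewrite /k0 patchE mem_set//; apply: (subI i); exact: set_mem.
pose U := \big[setU/set0]_(i < n) `]u i, v i[%classic.
have mU : measurable U by exact: bigsetU_measurable.
have muU : (mu U < d%:E)%E by rewrite (measure_interval_family uv) lte_fin.
apply: le_lt_trans (H U mU muU).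
apply: (@le_trans _ _ (\sum_i \int[mu]_(t in `]u i, v i[) `|k0 t|)).
  exact: ler_sum.
have iak0 : mu.-integrable setT (EFin \o (fun t => `|k0 t|)).
  exact: integrable_norm.
have mak0 := measurable_int mu iak0.
rewrite {2}/Rintegral ge0_integral_bigsetU//; last 3 first.
- exact: index_enum_uniq.
- by move=> i j _ _; exact: uv.2.
- exact: measurable_funS mak0.
rewrite -sum_fine//= => i _; apply: integrable_fin_num => //.
by apply: integrableS iak0.
Qed.

Lemma ac_deriv_Rintegral k : mu.-integrable `[0, 1] (EFin \o k) ->
  ac_deriv (fun x => \int[mu]_(t in `[0, x]) k t) k.
Proof.
move=> ik.
pose k0 := k \_ `[0, 1].
have ik0 : mu.-integrable setT (EFin \o k0).
  by rewrite /k0 -restrict_EFin -integrable_mkcond.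
have sub (x : R) : 0 <= x <= 1 -> `[0, x]%classic `<=` `[0, 1]%classic.
  by move=> x01 z/=; rewrite !in_itv/=; lra.
have E (x : R) : 0 <= x <= 1 ->
    \int[mu]_(t in `[0, x]) k0 t = \int[mu]_(t in `[0, x]) k t.
  move=> x01; apply: eq_Rintegral => t /set_mem tx.
  by rewrite /k0 patchE mem_set//; exact: sub tx.
have Ek (x : R) : 0 <= x <= 1 -> k0 x = k x.
  by move=> x01; rewrite /k0 patchE mem_set//= in_itv.
apply: (@ac_deriv_eq _ (fun x => \int[mu]_(t in `[0, x]) k0 t) k0) => //.
split.
  have ack := ac01_Rintegral ik.
  apply: (ac01_dominated (L := 1) ack ack) => u v u0 uv v1.
  by rewrite !E ?mul1r ?lerDl//; lra.
have ik0y y : mu.-integrable [set` Interval (BLeft 0) (BRight y)] (EFin \o k0).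
  exact: integrableS ik0.
have H := FTC1 ik0y (integrable_locally (measurable_itv _) ik).
apply: ae_imply2 (ae_neq 0) H => x xneq0 + /andP[x0 _].
have {}x0 : 0 < x by rewrite lt_neqAle eq_sym xneq0.
by rewrite lte_fin => /(_ x0) [dx Dx]; split; rewrite -?derive1E.
Qed.

(** With K the integral of k, the function u e^{-K} has derivative
    (g - k u) e^{-K}, which is nonpositive. *)
Lemma ac_gronwall (u g k : R -> R) (b : R) : 0 <= b <= 1 ->
  mu.-integrable `[0, 1] (EFin \o k) -> ac_deriv u g ->
  {ae mu, forall x, 0 <= x <= b -> g x <= k x * u x} ->
  u b <= u 0 * expR (\int[mu]_(t in `[0, b]) k t).
Proof.
move=> b01 ik ug gk.
pose K x := \int[mu]_(t in `[0, x]) k t.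
have dK : ac_deriv K k by exact: ac_deriv_Rintegral.
have [ach dh] := ac_derivM ug (ac_deriv_expR (ac_derivN dK)).
have K0 : K 0 = 0 by rewrite /K set_itv1 Rintegral_set1.
have : u b * expR (- K b) <= u 0 * expR (- K 0).
  apply: (ac01_nonincreasing b01 ach).
  apply: ae_imply2 dh gk => x hx gx /andP[x0 xb]; split.
    by apply: hx; lra.
  have := gx (introT andP (conj x0 xb)).
  have := expR_ge0 (- K x).
  move: (expR (- K x)) => E E0 gk'.
  have := ler_wpM2r E0 gk'; nra.
by rewrite K0 oppr0 expR0 mulr1 expRN -ler_pdivlMr ?invr_gt0 ?expR_gt0// invrK.
Qed.

End IndefiniteIntegral.

(** * Complex-valued functions *)

Section ComplexDeriv.
Context {R : realType}.
Local Notation mu := (@lebesgue_measure R).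
Implicit Types (f g : R -> R[i]) (z w : R[i]).

Lemma ReM z w : Re (z * w) = Re z * Re w - Im z * Im w.
Proof. by case: z => a b; case: w. Qed.

Lemma ImM z w : Im (z * w) = Re z * Im w + Im z * Re w.
Proof. by case: z => a b; case: w. Qed.

Lemma ReD z w : Re (z + w) = Re z + Re w.
Proof. by case: z => a b; case: w. Qed.

Lemma ImD z w : Im (z + w) = Im z + Im w.
Proof. by case: z => a b; case: w. Qed.

Lemma ReN z : Re (- z) = - Re z. Proof. by case: z. Qed.

Lemma ImN z : Im (- z) = - Im z. Proof. by case: z. Qed.

Definition abs2 z : R := Re z ^+ 2 + Im z ^+ 2.

Lemma abs2_ge0 z : 0 <= abs2 z.
Proof. by rewrite addr_ge0 ?sqr_ge0. Qed.

Lemma abs2_0 : abs2 0 = 0.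
Proof. by rewrite /abs2 expr0n addr0. Qed.

Lemma normc_ge0 z : 0 <= normc z.
Proof. by case: z => a b; exact: sqrtr_ge0. Qed.

Lemma sqr_normc z : normc z ^+ 2 = abs2 z.
Proof. by case: z => a b; rewrite /normc sqr_sqrtr ?(abs2_ge0 (a +i* b)). Qed.

Lemma normc_le_sqr z (c : R) : 0 <= c -> abs2 z <= c ^+ 2 -> normc z <= c.
Proof. by move=> c0; rewrite -sqr_normc ler_sqr ?nnegrE// normc_ge0. Qed.

Lemma normc_ge_absRe z : `|Re z| <= normc z.
Proof.
rewrite -ler_sqr ?nnegrE ?normc_ge0// sqr_normc real_normK ?num_real//.
by rewrite /abs2 lerDl sqr_ge0.
Qed.

Lemma normc_ge_absIm z : `|Im z| <= normc z.
Proof.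
rewrite -ler_sqr ?nnegrE ?normc_ge0// sqr_normc real_normK ?num_real//.
by rewrite /abs2 lerDr sqr_ge0.
Qed.

Lemma normcD z w : normc (z + w) <= normc z + normc w.
Proof. exact: le_normcD. Qed.

Lemma normc_real (a : R) : normc a%:C = `|a|.
Proof. by rewrite /normc/= expr0n/= addr0 sqrtr_sqr. Qed.

Lemma normci : normc ('i%C : R[i]) = 1.
Proof. by rewrite /normc/= expr0n/= add0r expr1n sqrtr1. Qed.

Lemma normc_cexp z : normc (cexp z) = expR (Re z).
Proof.
rewrite /cexp normcM normc_real ger0_norm ?expR_ge0// /normc/=.
by rewrite cos2Dsin2 sqrtr1 mulr1.
Qed.

Lemma cexpD z w : cexp (z + w) = cexp z * cexp w.
Proof.
rewrite /cexp ReD ImD expRD cosD sinD.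
by apply/eqP; rewrite eq_complex; apply/andP; split; apply/eqP;
  rewrite !(ReM, ImM)/=; ring.
Qed.

Lemma cexp0 : cexp (0 : R[i]) = 1.
Proof.
by rewrite /cexp/= expR0 cos0 sin0 mul1r.
Qed.

Definition cac_deriv f g : Prop :=
  ac_deriv (fun x => Re (f x)) (fun x => Re (g x)) /\
  ac_deriv (fun x => Im (f x)) (fun x => Im (g x)).

Lemma cac_deriv_eq f g f' g' : (forall x : R, 0 <= x <= 1 -> f x = f' x) ->
  (forall x : R, 0 <= x <= 1 -> g x = g' x) -> cac_deriv f g -> cac_deriv f' g'.
Proof.
by move=> ff' gg' [r i]; split; [apply: ac_deriv_eq r|apply: ac_deriv_eq i];
  move=> x x01; rewrite -?ff'// -?gg'.
Qed.

Lemma cac_deriv_cst z : cac_deriv (cst z) (cst 0).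
Proof. by split; exact: ac_deriv_cst. Qed.

Lemma cac_derivD f1 f2 g1 g2 : cac_deriv f1 g1 -> cac_deriv f2 g2 ->
  cac_deriv (fun x => f1 x + f2 x) (fun x => g1 x + g2 x).
Proof.
move=> [r1 i1] [r2 i2]; split.
- apply: ac_deriv_eq (ac_derivD r1 r2) => x _; by rewrite ReD.
- apply: ac_deriv_eq (ac_derivD i1 i2) => x _; by rewrite ImD.
Qed.

Lemma cac_derivM f1 f2 g1 g2 : cac_deriv f1 g1 -> cac_deriv f2 g2 ->
  cac_deriv (fun x => f1 x * f2 x) (fun x => g1 x * f2 x + f1 x * g2 x).
Proof.
move=> [r1 i1] [r2 i2]; split.
- apply: ac_deriv_eq (ac_derivD (ac_derivM r1 r2) (ac_derivN (ac_derivM i1 i2))).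
  + by move=> x _; rewrite ReM.
  + by move=> x _; rewrite ReD !ReM; ring.
- apply: ac_deriv_eq (ac_derivD (ac_derivM r1 i2) (ac_derivM i1 r2)).
  + by move=> x _; rewrite ImM.
  + by move=> x _; rewrite ImD !ImM; ring.
Qed.

Lemma cac_derivZ z f g : cac_deriv f g ->
  cac_deriv (fun x => z * f x) (fun x => z * g x).
Proof.
move=> /(cac_derivM (cac_deriv_cst z)); apply: cac_deriv_eq => // x _.
by rewrite mul0r add0r.
Qed.

Lemma cac_derivB f1 f2 g1 g2 : cac_deriv f1 g1 -> cac_deriv f2 g2 ->
  cac_deriv (fun x => f1 x - f2 x) (fun x => g1 x - g2 x).
Proof.
move=> d1 /(cac_derivZ (-1)) /(cac_derivD d1); apply: cac_deriv_eq => x _;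
  by rewrite mulN1r.
Qed.

Lemma ac_deriv_abs2 f g : cac_deriv f g ->
  ac_deriv (fun x => abs2 (f x))
           (fun x => 2 * (Re (f x) * Re (g x) + Im (f x) * Im (g x))).
Proof.
move=> [r i]; apply: ac_deriv_eq (ac_derivD (ac_derivM r r) (ac_derivM i i)).
- by move=> x _; rewrite /abs2 !expr2.
- by move=> x _; ring.
Qed.

Lemma ac_deriv_linear (c : R) : ac_deriv (fun x => c * x) (cst c).
Proof.
apply: ac_deriv_eq (ac_derivM (ac_deriv_cst c) ac_deriv_id) => // x _ /=.
by rewrite mul0r add0r mulr1.
Qed.

Lemma cexp_lineE z (x : R) :
  (Re (cexp (z * x%:C)) = expR (Re z * x) * cos (Im z * x)) *
  (Im (cexp (z * x%:C)) = expR (Re z * x) * sin (Im z * x)).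
Proof.
rewrite /cexp !(ReM, ImM)/= !mulr0 subr0 add0r !mul0r addr0.
by split; [rewrite subr0|].
Qed.

Lemma cac_deriv_cexp z :
  cac_deriv (fun x => cexp (z * x%:C)) (fun x => z * cexp (z * x%:C)).
Proof.
have dE := ac_deriv_expR (ac_deriv_linear (Re z)).
have dC := ac_deriv_cos (ac_deriv_linear (Im z)).
have dS := ac_deriv_sin (ac_deriv_linear (Im z)).
split.
- apply: ac_deriv_eq (ac_derivM dE dC) => x _; first by rewrite cexp_lineE.
  by rewrite [RHS]ReM !cexp_lineE/=; ring.
- apply: ac_deriv_eq (ac_derivM dE dS) => x _; first by rewrite cexp_lineE.
  by rewrite [RHS]ImM !cexp_lineE/=; ring.
Qed.

Lemma cac_deriv_cintegral f : cintegrable `[0, 1]%classic f ->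
  cac_deriv (fun x => cintegral `[0, x]%classic f) f.
Proof. by move=> [r i]; split; exact: ac_deriv_Rintegral. Qed.

Lemma cac_bounded f g : cac_deriv f g -> exists M : R,
  forall x : R, 0 <= x <= 1 -> normc (f x) <= M.
Proof.
move=> [[/ac01_bounded [M1 M10 h1] _] [/ac01_bounded [M2 M20 h2] _]].
exists (M1 + M2) => x x01; apply: normc_le_sqr; first by rewrite addr_ge0 ?ltW.
have := h1 x x01; have := h2 x x01; rewrite /abs2 -(real_normK (num_real (Re _))).
rewrite -(real_normK (num_real (Im _))).
have := normr_ge0 (Re (f x)); have := normr_ge0 (Im (f x)); nra.
Qed.

Lemma abs_continuous_Re f : abs_continuous 0 1 f -> ac01 (fun x => Re (f x)).
Proof.
move=> acf e e0; have [d d0 H] := acf e e0; exists d => // n u v [uv tI] len.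
apply: le_lt_trans (H n u v uv tI len); apply: ler_sum => i _.
by apply: le_trans (normc_ge_absRe _); rewrite ReD ReN.
Qed.

Lemma abs_continuous_Im f : abs_continuous 0 1 f -> ac01 (fun x => Im (f x)).
Proof.
move=> acf e e0; have [d d0 H] := acf e e0; exists d => // n u v [uv tI] len.
apply: le_lt_trans (H n u v uv tI len); apply: ler_sum => i _.
by apply: le_trans (normc_ge_absIm _); rewrite ImD ImN.
Qed.

Lemma cac_deriv_ae f g : abs_continuous 0 1 f ->
  {ae mu, forall x, 0 <= x <= 1 -> cderivable f x /\ cderive1 f x = g x} ->
  cac_deriv f g.
Proof.
move=> acf H; split; split.
- exact: abs_continuous_Re.
- apply: ae_imply H => x /[apply] -[[dr _] <-] /=; split=> //; by rewrite derive1E.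
- exact: abs_continuous_Im.
- apply: ae_imply H => x /[apply] -[[_ di] <-] /=; split=> //; by rewrite derive1E.
Qed.

Lemma cintegrableB f g : cintegrable `[0, 1]%classic f ->
  cintegrable `[0, 1]%classic g ->
  cintegrable `[0, 1]%classic (fun x => f x - g x).
Proof.
move=> [rf imf] [rg ig]; split.
- apply: eq_integrable (integrableB _ rf rg) => // x _ /=.
  by rewrite ReD ReN.
- apply: eq_integrable (integrableB _ imf ig) => // x _ /=.
  by rewrite ImD ImN.
Qed.

Lemma integrable_mul_ac01 (h k : R -> R) : ac01 h -> measurable_fun setT h ->
  mu.-integrable `[0, 1] (EFin \o k) ->
  mu.-integrable `[0, 1] (EFin \o (fun x => k x * h x)).
Proof.
move=> /ac01_bounded [M M0 hM] mh ik.
have := @integrableMl _ _ _ mu `[0, 1]%classic (measurable_itv _) _ h ik.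
move=> /(_ (measurable_funTS mh)); apply.
exists M; split; first exact: num_real.
move=> M' MM' x /=; rewrite in_itv/= => x01; apply: le_trans (hM x x01) (ltW MM').
Qed.

Lemma cintegrable_cexp f z : cintegrable `[0, 1]%classic f ->
  cintegrable `[0, 1]%classic (fun x => f x * cexp (z * x%:C)).
Proof.
move=> [rf imf]; have [[rE _] [iE _]] := cac_deriv_cexp z.
have cl (c : R) : continuous (fun x : R => c * x).
  by move=> x; exact: mulrl_continuous.
have mE : measurable_fun setT (fun x : R => expR (Re z * x)).
  apply: continuous_measurable_fun => x.
  exact: (continuous_comp (cl _ x) (@continuous_expR _ _)).
have mR : measurable_fun setT (fun x : R => Re (cexp (z * x%:C))).
  apply: (eq_measurable_fun (fun x : R => expR (Re z * x) * cos (Im z * x))).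
    by move=> x _; rewrite cexp_lineE.
  apply: measurable_funM => //; apply: continuous_measurable_fun => x.
  exact: (continuous_comp (cl _ x) (@continuous_cos _ _)).
have mI : measurable_fun setT (fun x : R => Im (cexp (z * x%:C))).
  apply: (eq_measurable_fun (fun x : R => expR (Re z * x) * sin (Im z * x))).
    by move=> x _; rewrite cexp_lineE.
  apply: measurable_funM => //; apply: continuous_measurable_fun => x.
  exact: (continuous_comp (cl _ x) (@continuous_sin _ _)).
have m1 := integrable_mul_ac01 rE mR rf; have m2 := integrable_mul_ac01 iE mI imf.
have m3 := integrable_mul_ac01 iE mI rf; have m4 := integrable_mul_ac01 rE mR imf.
split.
- apply: eq_integrable (integrableB _ m1 m2) => // x _.
  by rewrite ReM EFinB.
- apply: eq_integrable (integrableD _ m3 m4) => // x _.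
  by rewrite ImM EFinD.
Qed.

End ComplexDeriv.

(** * The energy estimate and the corrected difference *)

Section Comparison.
Context {R : realType}.
Local Notation mu := (@lebesgue_measure R).
Implicit Types (f q h y z : R -> R[i]) (lam : R[i]).

(** The real inner product of the plane: 2 (rdot f f') is the derivative of
    |f|^2. *)
Definition rdot (z w : R[i]) : R := Re z * Re w + Im z * Im w.

Lemma rdotD (z w w' : R[i]) : rdot z (w + w') = rdot z w + rdot z w'.
Proof. by rewrite /rdot ReD ImD; ring. Qed.

Lemma rdot_le (z w : R[i]) : rdot z w <= normc z * normc w.
Proof.
apply: le_trans (ler_norm _) _.
rewrite -ler_sqr ?nnegrE ?mulr_ge0 ?normc_ge0// real_normK ?num_real//.
rewrite exprMn !sqr_normc /rdot /abs2.
by have := sqr_ge0 (Re z * Im w - Im z * Re w); nra.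
Qed.

(** The lambda-term of the system turns z when lambda is real; only Im lambda
    contributes to the growth of |z|. *)
Lemma rdot_rotation (z w : R[i]) (c : R) :
  rdot z ('i%C * c%:C * w * z) = - (c * Im w) * normc z ^+ 2.
Proof.
by rewrite sqr_normc /rdot /abs2 !(ReM, ImM)/=; ring.
Qed.

Lemma rdot_system (z z' q h lam : R[i]) (c b : R) : `|c| <= b ->
  rdot z ('i%C * c%:C * (lam * z - q * z') + h) <=
    b * `|Im lam| * normc z ^+ 2 + b * normc q * (normc z * normc z') +
    normc h * normc z.
Proof.
move=> cb.
have -> : 'i%C * c%:C * (lam * z - q * z') + h =
  'i%C * c%:C * lam * z + - ('i%C * c%:C * q * z') + h by ring.
rewrite !rdotD rdot_rotation; apply: lerD; first apply: lerD.
- rewrite ler_wpM2r ?sqr_ge0//; apply: le_trans (ler_norm _) _.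
  by rewrite normrN normrM ler_wpM2r.
- apply: le_trans (rdot_le _ _) _.
  rewrite normcN !normcM normci normc_real mul1r.
  rewrite (_ : _ * _ = `|c| * (normc q * (normc z * normc z'))); last by ring.
  by rewrite -mulrA ler_wpM2r// !mulr_ge0 ?normc_ge0.
- by apply: le_trans (rdot_le _ _) _; rewrite mulrC.
Qed.

(** The quantity |f_1|^2 + |f_2|^2 + A^2 e^{2 b |Im lambda| x} obeys a linear
    differential inequality.  The last summand absorbs the forcing: since h_j is
    at most D k times A e^{b |Im lambda| x}, the arithmetic-geometric inequality
    bounds 2 |h_j| |f_j| by D k (A^2 e^{2 b |Im lambda| x} + |f_j|^2). *)
Lemma energy_estimate lam (b c1 c2 D A X : R) f1 f2 q1 q2 h1 h2 (k : R -> R) :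
  0 <= X <= 1 -> `|c1| <= b -> `|c2| <= b -> 0 <= D -> 0 <= A ->
  mu.-integrable `[0, 1] (EFin \o k) ->
  (forall x, 0 <= x <= 1 -> normc (q1 x) + normc (q2 x) <= k x) ->
  cac_deriv f1 (fun x => 'i%C * c1%:C * (lam * f1 x - q1 x * f2 x) + h1 x) ->
  cac_deriv f2 (fun x => 'i%C * c2%:C * (lam * f2 x - q2 x * f1 x) + h2 x) ->
  (forall x, 0 <= x <= X ->
    normc (h1 x) <= D * k x * (A * expR (b * `|Im lam| * x))) ->
  (forall x, 0 <= x <= X ->
    normc (h2 x) <= D * k x * (A * expR (b * `|Im lam| * x))) ->
  abs2 (f1 X) + abs2 (f2 X) <= (abs2 (f1 0) + abs2 (f2 0) + A ^+ 2) *
    expR (2 * (b * `|Im lam|) * X + (b + 2 * D) * \int[mu]_(t in `[0, X]) k t).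
Proof.
move=> X01 c1b c2b D0 A0 ik qk d1 d2 hb1 hb2.
set be := b * `|Im lam|.
have b0 : 0 <= b by exact: le_trans c1b.
have be0 : 0 <= be by rewrite mulr_ge0.
pose K x := 2 * be + (b + 2 * D) * k x.
have icst : mu.-integrable `[0, 1] (EFin \o cst (2 * be)).
  apply: measurable_bounded_integrable => //.
    by rewrite /= lebesgue_measure_itv/= lte_fin ltr01 ltry.
  exists (2 * be); split; first exact: num_real.
  by move=> M bM t _ /=; rewrite ger0_norm ?mulr_ge0// ltW.
have iDk : mu.-integrable `[0, 1] (EFin \o (fun x => (b + 2 * D) * k x)).
  by apply: eq_integrable (integrableZl _ (b + 2 * D) ik).
have iK : mu.-integrable `[0, 1] (EFin \o K).
  by apply: eq_integrable (integrableD _ icst iDk).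
have sX : `[0, X]%classic `<=` `[0, 1]%classic.
  by move=> t /=; rewrite !in_itv/=; lra.
have -> : 2 * be * X + (b + 2 * D) * \int[mu]_(t in `[0, X]) k t =
    \int[mu]_(t in `[0, X]) K t.
  rewrite RintegralD//; [|exact: integrableS icst|exact: integrableS iDk].
  have ikX : mu.-integrable `[0, X] (EFin \o k) by apply: integrableS ik.
  rewrite (RintegralZl _ _ ikX)//.
  have lenX : X = fine (mu `[0, X]).
    rewrite lebesgue_measure_itv/= lte_fin; case: ltgtP X01 => //= _ _.
    by rewrite subr0.
  by congr (_ + _); rewrite Rintegral_cst//; congr (_ * _).
pose u x := abs2 (f1 x) + abs2 (f2 x) + A ^+ 2 * expR (2 * be * x).
have dE := ac_derivM (ac_deriv_cst (A ^+ 2))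
  (ac_deriv_expR (ac_deriv_linear (2 * be))).
have du := ac_derivD (ac_derivD (ac_deriv_abs2 d1) (ac_deriv_abs2 d2)) dE.
have := ac_gronwall X01 iK du.
rewrite !mulr0 expR0 mulr1 => H.
apply: (le_trans _ (H _)); first by rewrite lerDl mulr_ge0 ?sqr_ge0 ?expR_ge0.
apply: aeW => x x0X /=.
have x01 : 0 <= x <= 1 by lra.
have := rdot_system (f1 x) (f2 x) (q1 x) (h1 x) lam c1b.
have := rdot_system (f2 x) (f1 x) (q2 x) (h2 x) lam c2b.
rewrite -/be /rdot /cst mul0r add0r.
set r1 := Re (f1 x) * _ + _; set r2 := Re (f2 x) * _ + _.
have := hb1 x x0X; have := hb2 x x0X; have := qk x x01.
have -> : 2 * be * x = be * x + be * x by ring.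
rewrite -/be expRD -!sqr_normc.
have := normc_ge0 (f1 x); have := normc_ge0 (f2 x).
have := normc_ge0 (q1 x); have := normc_ge0 (q2 x).
set e := expR (be * x).
have : 0 <= A * e by rewrite mulr_ge0 ?expR_ge0.
have -> : A ^+ 2 * (e * e) = (A * e) ^+ 2 by ring.
have -> : A ^+ 2 * (e * e * (2 * be)) = 2 * be * (A * e) ^+ 2 by ring.
move: (A * e) (normc (f1 x)) (normc (f2 x)) (normc (q1 x)) (normc (q2 x))
  (normc (h1 x)) (normc (h2 x)) (r1) (r2) => a n1 n2 m1 m2 g1 g2 s1 s2
  a0 m20 m10 n20 n10 mk H2 H1 S2 S1.
have kx0 : 0 <= k x by lra.
have E1 : g1 * n1 <= D * k x * (a * n1).
  by rewrite mulrA ler_wpM2r.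
have E2 : g2 * n2 <= D * k x * (a * n2).
  by rewrite mulrA ler_wpM2r.
have Dk0 : 0 <= D * k x by rewrite mulr_ge0.
have F1 : D * k x * (2 * (a * n1)) <= D * k x * (a ^+ 2 + n1 ^+ 2).
  by rewrite ler_wpM2l//; have := sqr_ge0 (a - n1); nra.
have F2 : D * k x * (2 * (a * n2)) <= D * k x * (a ^+ 2 + n2 ^+ 2).
  by rewrite ler_wpM2l//; have := sqr_ge0 (a - n2); nra.
have G1 : b * m1 * (n1 * n2) + b * m2 * (n2 * n1) <= b * k x * (n1 * n2).
  rewrite (_ : _ + _ = b * (m1 + m2) * (n1 * n2)); last by ring.
  by rewrite ler_wpM2r ?mulr_ge0// ler_wpM2l.
have G2 : b * k x * (2 * (n1 * n2)) <= b * k x * (n1 ^+ 2 + n2 ^+ 2 + a ^+ 2).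
  rewrite ler_wpM2l ?mulr_ge0//.
  by have := sqr_ge0 (n1 - n2); have := sqr_ge0 a; nra.
have F3 : 0 <= D * k x * (n1 ^+ 2 + n2 ^+ 2).
  by rewrite mulr_ge0// addr_ge0 ?sqr_ge0.
rewrite /K; move: S1 S2 E1 E2 F1 F2 F3 G1 G2; nra.
Qed.

(** Integration by parts in differential form.  Differentiating the correction
    i c_j e P_j z_k cancels the forcing -i c_j (q_j - p_j) z_k because
    e e' = 1, and what remains of the derivative of e and z_k turns into the
    lambda-term of E_j and the term with P_j p_k.  The term with P_k q_j arises
    from writing y_k - z_k as E_k minus its own correction. *)
Lemma corrected_difference_deriv lam (cj ck : R) qj pj pk Pj Pk yj yk zj zk :
  let e x := cexp ('i%C * (cj - ck)%:C * lam * x%:C) in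
  let e' x := cexp ('i%C * (ck - cj)%:C * lam * x%:C) in
  let Ej x := yj x - zj x + 'i%C * cj%:C * (e x * Pj x * zk x) in
  let Ek x := yk x - zk x + 'i%C * ck%:C * (e' x * Pk x * zj x) in
  cac_deriv yj (fun x => 'i%C * cj%:C * (lam * yj x - qj x * yk x)) ->
  cac_deriv zj (fun x => 'i%C * cj%:C * (lam * zj x - pj x * zk x)) ->
  cac_deriv zk (fun x => 'i%C * ck%:C * (lam * zk x - pk x * zj x)) ->
  cac_deriv Pj (fun x => (qj x - pj x) * e' x) ->
  cac_deriv Ej (fun x => 'i%C * cj%:C * (lam * Ej x - qj x * Ek x) +
    cj%:C * ck%:C * (e x * Pj x * pk x - e' x * Pk x * qj x) * zj x).
Proof.
move=> e e' Ej Ek dyj dzj dzk dP.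
have de := cac_deriv_cexp ('i%C * (cj - ck)%:C * lam).
have := cac_derivD (cac_derivB dyj dzj)
  (cac_derivZ ('i%C * cj%:C) (cac_derivM (cac_derivM de dP) dzk)).
apply: cac_deriv_eq => // x _; rewrite -/(e x).
have ee : e x * e' x = 1.
  rewrite /e /e' -cexpD -cexp0; congr cexp; rewrite !rmorphB/=; ring.
have ii : 'i%C * 'i%C = -1 :> R[i] by rewrite -expr2 sqr_i.
rewrite /Ej /Ek rmorphB/=.
move: ('i%C : R[i]) ii => i ii; move: (cj%:C) (ck%:C) => c d.
ring: ee ii.
Qed.

End Comparison.

(** * Comparison of two columns *)

Section Column.
Context {R : realType}.
Local Notation mu := (@lebesgue_measure R).
Implicit Types (lam : R[i]).

(** |e^{i c lambda x}| = e^{- c x Im lambda}. *)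
Lemma normc_cexp_rotation lam (c b x X : R) : `|c| <= b -> 0 <= x <= X ->
  normc (cexp ('i%C * c%:C * lam * x%:C)) <= expR (b * `|Im lam| * X).
Proof.
move=> cb /andP[x0 xX]; rewrite normc_cexp ler_expR.
have -> : Re ('i%C * c%:C * lam * x%:C) = - (c * Im lam) * x.
  by rewrite !(ReM, ImM)/=; ring.
have b0 : 0 <= b by apply: le_trans cb.
apply: (@le_trans _ _ (b * `|Im lam| * x)); last by rewrite ler_wpM2l ?mulr_ge0.
rewrite ler_wpM2r//; apply: le_trans (ler_norm _) _.
by rewrite normrN normrM ler_wpM2r.
Qed.

(** The energy estimate without forcing. *)
Lemma system_bound lam (b c1 c2 X rho : R) (z1 z2 p1 p2 : R -> R[i])
    (k : R -> R) :
  0 <= X <= 1 -> `|c1| <= b -> `|c2| <= b ->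
  mu.-integrable `[0, 1] (EFin \o k) ->
  (forall x : R, 0 <= x <= 1 -> normc (p1 x) + normc (p2 x) <= k x) ->
  \int[mu]_(t in `[0, X]) k t <= rho ->
  cac_deriv z1 (fun x => 'i%C * c1%:C * (lam * z1 x - p1 x * z2 x)) ->
  cac_deriv z2 (fun x => 'i%C * c2%:C * (lam * z2 x - p2 x * z1 x)) ->
  abs2 (z1 0) + abs2 (z2 0) = 1 ->
  normc (z1 X) <= expR (b * `|Im lam| * X) * expR (b * rho) /\
  normc (z2 X) <= expR (b * `|Im lam| * X) * expR (b * rho).
Proof.
move=> X01 c1b c2b ik pk krho d1 d2 z0.
have b0 : 0 <= b by apply: le_trans c1b.
(* The zero forcing, in the shape that the energy estimate expects. *)
have addz c f p g :
    cac_deriv f (fun x => 'i%C * c%:C * (lam * f x - p x * g x)) ->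
    cac_deriv f (fun x =>
      'i%C * c%:C * (lam * f x - p x * g x) + (cst 0 x : R[i])).
  by apply: cac_deriv_eq => // x _; rewrite addr0.
have h0 (x : R) : 0 <= x <= X ->
    normc (cst 0 x : R[i]) <= 0 * k x * (0 * expR (b * `|Im lam| * x)).
  by move=> _; rewrite !mul0r normc0.
have := energy_estimate X01 c1b c2b (lexx 0) (lexx 0) ik pk (addz _ _ _ _ d1)
  (addz _ _ _ _ d2) h0 h0.
rewrite z0 expr0n/= addr0 mul1r mulr0 addr0 => H.
have rho0 : 0 <= rho.
  apply: le_trans krho; apply: Rintegral_ge0 => t /=; rewrite in_itv/= => tX.
  by apply: le_trans (pk t _); [rewrite addr_ge0 ?normc_ge0|lra].
have H2 : abs2 (z1 X) + abs2 (z2 X) <=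
    (expR (b * `|Im lam| * X) * expR (b * rho)) ^+ 2.
  apply: (le_trans H); rewrite expr2 -!expRD ler_expR.
  have := ler_wpM2l b0 krho; have := mulr_ge0 b0 rho0.
  by set s := \int[mu]_(t in _) _; lra.
by split; (apply: normc_le_sqr; [by rewrite mulr_ge0 ?expR_ge0|]);
  apply: le_trans H2; rewrite ?lerDl ?lerDr abs2_ge0.
Qed.

Lemma forcing_bound (e e' P P' p q z : R[i]) (cj ck b k E S Z : R) :
  `|cj| <= b -> `|ck| <= b -> normc e <= E -> normc e' <= E ->
  normc P + normc P' <= S -> normc p <= k -> normc q <= k -> normc z <= Z ->
  normc (cj%:C * ck%:C * (e * P * p - e' * P' * q) * z) <=
    b ^+ 2 * k * (S * E * Z).
Proof.
move=> cjb ckb eE e'E PS pk qk zZ.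
rewrite !normcM !normc_real.
have n0 := @normc_ge0 R.
have b0 : 0 <= b by apply: le_trans cjb.
have E0 : 0 <= E by apply: le_trans eE.
have k0 : 0 <= k by apply: le_trans pk.
have Z0 : 0 <= Z by apply: le_trans zZ.
have -> : b ^+ 2 * k * (S * E * Z) = b * b * (S * (E * k)) * Z by ring.
apply: ler_pM; rewrite ?mulr_ge0 ?n0//.
apply: ler_pM; rewrite ?mulr_ge0 ?n0//; first exact: ler_pM.
apply: le_trans (normcD _ _) _; rewrite normcN !normcM.
apply: (@le_trans _ _ ((normc P + normc P') * (E * k))); last first.
  by rewrite ler_wpM2r// mulr_ge0.
rewrite mulrDl; apply: lerD.
- rewrite [normc e * _]mulrC -mulrA; apply: ler_wpM2l => //.
  exact: ler_pM.
- rewrite [normc e' * _]mulrC -mulrA; apply: ler_wpM2l => //.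
  exact: ler_pM.
Qed.

(** The corrected differences vanish at 0 and solve the forced system, with
    forcing at most b^2 k S E |z|, where E = e^{b |Im lambda| X} bounds the
    correcting exponentials and S bounds the oscillatory integrals.  The energy
    estimate bounds them, and the corrections themselves, at most
    b E S |z|, have the same order. *)
Lemma column_comparison lam (b c1 c2 X rho S : R)
    (q1 q2 p1 p2 P1 P2 y1 y2 z1 z2 : R -> R[i]) (k : R -> R) :
  0 <= X <= 1 -> `|c1| <= b -> `|c2| <= b -> `|c1 - c2| <= b ->
  mu.-integrable `[0, 1] (EFin \o k) ->
  (forall x : R, 0 <= x <= 1 ->
    normc (q1 x) + normc (q2 x) + (normc (p1 x) + normc (p2 x)) <= k x) ->
  \int[mu]_(t in `[0, 1]) k t <= rho ->
  cac_deriv y1 (fun x => 'i%C * c1%:C * (lam * y1 x - q1 x * y2 x)) ->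
  cac_deriv y2 (fun x => 'i%C * c2%:C * (lam * y2 x - q2 x * y1 x)) ->
  cac_deriv z1 (fun x => 'i%C * c1%:C * (lam * z1 x - p1 x * z2 x)) ->
  cac_deriv z2 (fun x => 'i%C * c2%:C * (lam * z2 x - p2 x * z1 x)) ->
  y1 0 = z1 0 -> y2 0 = z2 0 -> abs2 (z1 0) + abs2 (z2 0) = 1 ->
  cac_deriv P1 (fun x =>
    (q1 x - p1 x) * cexp ('i%C * (c2 - c1)%:C * lam * x%:C)) ->
  cac_deriv P2 (fun x =>
    (q2 x - p2 x) * cexp ('i%C * (c1 - c2)%:C * lam * x%:C)) ->
  P1 0 = 0 -> P2 0 = 0 ->
  (forall x : R, 0 <= x <= X -> normc (P1 x) + normc (P2 x) <= S) ->
  let bnd := expR (2 * (b * `|Im lam|) * X) * S *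
    (expR (b * rho) * (expR ((b + 2 * b ^+ 2) * rho) + b)) in
  normc (y1 X - z1 X) <= bnd /\ normc (y2 X - z2 X) <= bnd.
Proof.
move=> X01 c1b c2b c12b ik qpk krho dy1 dy2 dz1 dz2 yz1 yz2 z0.
move=> dP1 dP2 P10 P20 PS bnd.
have n0 := @normc_ge0 R.
have b0 : 0 <= b by apply: le_trans c1b.
have c21b : `|c2 - c1| <= b by rewrite distrC.
have k0 (x : R) : 0 <= x <= 1 -> 0 <= k x.
  by move=> x01; apply: le_trans (qpk x x01); rewrite !addr_ge0.
have krhoX (x : R) : 0 <= x <= 1 -> \int[mu]_(t in `[0, x]) k t <= rho.
  move=> x01; apply: le_trans krho.
  have H : 0 <= \int[mu]_(t in `]x, 1]) k t.
    by apply: Rintegral_ge0 => t /=; rewrite in_itv/= => tx; apply: k0; lra.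
  move: H; rewrite -(@Rintegral_itvB _ k (BLeft 0)) ?bnd_simp//; last 2 first.
    by case/andP: x01.
    by case/andP: x01.
  by rewrite subr_ge0.
have qk (x : R) : 0 <= x <= 1 -> normc (q1 x) + normc (q2 x) <= k x.
  by move=> x01; apply: le_trans (qpk x x01); rewrite lerDl addr_ge0.
have pk (x : R) : 0 <= x <= 1 -> normc (p1 x) + normc (p2 x) <= k x.
  by move=> x01; apply: le_trans (qpk x x01); rewrite lerDr addr_ge0.
pose Z := expR (b * rho).
pose E := expR (b * `|Im lam| * X).
have Z0 : 0 <= Z by exact: expR_ge0.
have E0 : 0 <= E by exact: expR_ge0.
have S0 : 0 <= S.
  by apply: le_trans (PS X _); [rewrite addr_ge0|lra].
have zb (x : R) : 0 <= x <= X -> normc (z1 x) <= expR (b * `|Im lam| * x) * Z /\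
    normc (z2 x) <= expR (b * `|Im lam| * x) * Z.
  move=> xX; have x01 : 0 <= x <= 1 by lra.
  exact: (system_bound x01 c1b c2b ik pk (krhoX x x01) dz1 dz2 z0).
have dE1 := corrected_difference_deriv P2 dy1 dz1 dz2 dP1 (yk := y2).
have dE2 := corrected_difference_deriv P1 dy2 dz2 dz1 dP2 (yk := y1).
set e12 := (fun x : R => cexp ('i%C * (c1 - c2)%:C * lam * x%:C)) in dE1 dE2.
set e21 := (fun x : R => cexp ('i%C * (c2 - c1)%:C * lam * x%:C)) in dE1 dE2.
have be12 (x : R) : 0 <= x <= X -> normc (e12 x) <= E.
  exact: normc_cexp_rotation.
have be21 (x : R) : 0 <= x <= X -> normc (e21 x) <= E.
  exact: normc_cexp_rotation.
have A0 : 0 <= S * E * Z by rewrite !mulr_ge0.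
have ZE (a : R) : S * E * Z * a = S * E * (a * Z) by ring.
have := energy_estimate X01 c1b c2b (sqr_ge0 b) A0 ik qk dE1 dE2.
rewrite P10 P20 yz1 yz2 !subrr !(mulr0, mul0r) !addr0 abs2_0 addr0 add0r.
move=> H.
have {}H : abs2 (y1 X - z1 X + 'i%C * c1%:C * (e12 X * P1 X * z2 X)) +
    abs2 (y2 X - z2 X + 'i%C * c2%:C * (e21 X * P2 X * z1 X)) <=
    (S * E * Z * (E * expR ((b + 2 * b ^+ 2) * rho))) ^+ 2.
  apply: (le_trans (H _ _)).
  - move=> x xX; have x01 : 0 <= x <= 1 by lra.
    rewrite ZE; apply: forcing_bound => //; [exact: be12|exact: be21|exact: PS|..].
    + by apply: le_trans (pk x x01); rewrite lerDr.
    + by apply: le_trans (qk x x01); rewrite lerDl.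
    + by have [] := zb x xX.
  - move=> x xX; have x01 : 0 <= x <= 1 by lra.
    rewrite ZE; apply: forcing_bound => //; [exact: be21|exact: be12| |..].
    + by rewrite addrC; exact: PS.
    + by apply: le_trans (pk x x01); rewrite lerDl.
    + by apply: le_trans (qk x x01); rewrite lerDr.
    + by have [] := zb x xX.
  - rewrite [leRHS]exprMn ler_wpM2l ?sqr_ge0// [leRHS]expr2 /E -!expRD ler_expR.
    have bb0 : 0 <= b + 2 * b ^+ 2 by rewrite addr_ge0 ?mulr_ge0 ?sqr_ge0.
    have rho0 : 0 <= rho.
      apply: le_trans (krhoX X X01); apply: Rintegral_ge0 => t /=.
      by rewrite in_itv/= => tX; apply: k0; lra.
    have := ler_wpM2l bb0 (krhoX X X01); have := mulr_ge0 bb0 rho0.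
    by set s := \int[mu]_(t in _) _; lra.
have [z1X z2X] := zb X (introT andP (conj (andP X01).1 (lexx X))).
have fin (w z e P : R[i]) (c : R) : `|c| <= b -> normc e <= E -> normc P <= S ->
    normc z <= E * Z ->
    abs2 (w + 'i%C * c%:C * (e * P * z)) <=
      (S * E * Z * (E * expR ((b + 2 * b ^+ 2) * rho))) ^+ 2 ->
    normc w <= bnd.
  move=> cb eE PS' zEZ /normc_le_sqr hw.
  rewrite -[w](addrK ('i%C * c%:C * (e * P * z))).
  apply: le_trans (normcD _ _) _; rewrite normcN.
  have -> : bnd = S * E * Z * (E * expR ((b + 2 * b ^+ 2) * rho)) +
      b * (E * S * (E * Z)).
    have -> : bnd = expR (b * `|Im lam| * X + b * `|Im lam| * X) * S *
        (Z * (expR ((b + 2 * b ^+ 2) * rho) + b)).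
      by rewrite /bnd -/Z; congr (expR _ * _ * _); ring.
    by rewrite expRD -/E; ring.
  apply: lerD; first by apply: hw; rewrite !mulr_ge0 ?expR_ge0.
  rewrite !normcM normci normc_real mul1r; apply: ler_pM => //.
    by rewrite !mulr_ge0.
  by apply: ler_pM => //; [rewrite mulr_ge0|apply: ler_pM].
have PSX := PS X (introT andP (conj (andP X01).1 (lexx X))).
have XX : 0 <= X <= X by rewrite lexx; lra.
split.
- apply: (fin _ (z2 X) (e12 X) (P1 X) c1) => //; first exact: be12.
    by apply: le_trans PSX; rewrite lerDl.
  by apply: le_trans H; rewrite lerDl abs2_ge0.
- apply: (fin _ (z1 X) (e21 X) (P2 X) c2) => //; first exact: be21.
    by apply: le_trans PSX; rewrite lerDr.
  by apply: le_trans H; rewrite lerDr abs2_ge0.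
Qed.

End Column.

(** * Equivalence of norms on 2 x 2 matrices *)

Section FiniteDimensionalNorm.
Context {R : realType}.
Local Notation mu := (@lebesgue_measure R).
Variables (N : 'M[R[i]]_2 -> R) (hN : is_norm N).

Lemma is_norm0 : N 0 = 0.
Proof.
rewrite -[X in N X](scale0r (0 : 'M[R[i]]_2)) (norm_scale hN).
by rewrite normc0 mul0r.
Qed.

Lemma is_norm_sum (I : Type) (s : seq I) (F : I -> 'M[R[i]]_2) :
  N (\sum_(i <- s) F i) <= \sum_(i <- s) N (F i).
Proof.
elim/big_ind2 : _ => [||//]; first by rewrite is_norm0.
move=> A x B y Ax By; apply: le_trans (norm_triangle hN _ _) _.
exact: lerD.
Qed.

(** Expansion in the basis of elementary matrices. *)
Lemma is_norm_upper : exists2 c : R, 0 < c &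
  forall A, N A <= c * \sum_j \sum_k normc (A j k).
Proof.
pose c := 1 + \sum_(j < 2) \sum_(k < 2) N (delta_mx j k).
have dc j k : N (delta_mx j k) <= c.
  have row_le : N (delta_mx j k) <= \sum_(k' < 2) N (delta_mx j k').
    by rewrite (bigD1 k)//= lerDl sumr_ge0// => *; exact: norm_ge0.
  apply: le_trans row_le _.
  apply: (@le_trans _ _ (\sum_(j' < 2) \sum_(k' < 2) N (delta_mx j' k'))).
    rewrite [leRHS](bigD1 j)//= lerDl sumr_ge0// => *; rewrite sumr_ge0// => *.
    exact: norm_ge0.
  by rewrite /c lerDr.
have c0 : 0 < c.
  rewrite ltr_pwDl// sumr_ge0// => j _; rewrite sumr_ge0// => k _.
  exact: norm_ge0.
exists c => // A; rewrite [X in N X](matrix_sum_delta A).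
apply: le_trans (is_norm_sum _ _) _; rewrite mulr_sumr; apply: ler_sum => j _.
apply: le_trans (is_norm_sum _ _) _; rewrite mulr_sumr; apply: ler_sum => k _.
by rewrite (norm_scale hN) mulrC ler_wpM2r ?normc_ge0.
Qed.

Local Notation I8 := ('I_2 * 'I_2 * bool)%type.
Local Notation n8 := #|{: I8}|.

(** The eight real coordinates of a complex matrix are indexed by row, column,
    and real (false) or imaginary (true) part.  In these coordinates a norm is a
    continuous function and the unit sphere is compact. *)
Definition mx_of_row (v : 'rV[R]_n8) : 'M[R[i]]_2 :=
  \matrix_(j, k) (v ord0 (enum_rank (j, k, false)) +i*
                  v ord0 (enum_rank (j, k, true))).

Definition row_of_mx (A : 'M[R[i]]_2) : 'rV[R]_n8 :=
  \row_l let: (j, k, im) := enum_val l in if im then Im (A j k) else Re (A j k).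

Lemma row_of_mxK : cancel row_of_mx mx_of_row.
Proof.
by move=> A; apply/matrixP => j k; rewrite !mxE !enum_rankK; case: (A j k).
Qed.

Lemma mx_of_rowB v w : mx_of_row (v - w) = mx_of_row v - mx_of_row w.
Proof. by apply/matrixP => j k; rewrite !mxE. Qed.

Lemma mx_of_rowZ (c : R) v : mx_of_row (c *: v) = c%:C *: mx_of_row v.
Proof.
apply/matrixP => j k; rewrite !mxE; apply/eqP.
by rewrite eq_complex ReM ImM/= !mul0r subr0 addr0 !eqxx.
Qed.

Lemma mx_of_row_eq0 v : mx_of_row v = 0 -> v = 0.
Proof.
move=> v0; apply/rowP => l; rewrite mxE -(enum_valK l).
case: (enum_val l) => -[j k] im.
move/matrixP : v0 => /(_ j k); rewrite !mxE => -[re0 im0].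
by case: im.
Qed.

Lemma row_coord_le (v : 'rV[R]_n8) l : `|v ord0 l| <= `|v|.
Proof.
rewrite [leRHS]/Num.norm/= mx_normrE.
exact: (le_bigmax _ (fun ij => `|v ij.1 ij.2|) (ord0, l)).
Qed.

Lemma normc_mx_of_row_le v j k : normc (mx_of_row v j k) <= 2 * `|v|.
Proof.
apply: normc_le_sqr; first by rewrite mulr_ge0.
rewrite mxE /abs2/= -[_ ^+ 2 in leLHS]real_normK ?num_real//.
rewrite -[X in _ + X <= _]real_normK ?num_real//.
have := row_coord_le v (enum_rank (j, k, false)).
have := row_coord_le v (enum_rank (j, k, true)).
have := normr_ge0 (v ord0 (enum_rank (j, k, false))).
have := normr_ge0 (v ord0 (enum_rank (j, k, true))).
nra.
Qed.

Lemma is_norm_row_lipschitz : exists2 L : R, 0 < L &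
  forall v w : 'rV[R]_n8, `|N (mx_of_row v) - N (mx_of_row w)| <= L * `|v - w|.
Proof.
have [c c0 Hc] := is_norm_upper.
have half (v w : 'rV[R]_n8) :
    N (mx_of_row v) - N (mx_of_row w) <= c * 8 * `|v - w|.
  rewrite lerBlDr; have := norm_triangle hN (mx_of_row (v - w)) (mx_of_row w).
  rewrite mx_of_rowB subrK => /le_trans; apply.
  rewrite lerD2r -mx_of_rowB; apply: le_trans (Hc _) _.
  rewrite -mulrA ler_wpM2l ?(ltW c0)//.
  rewrite !big_ord_recl !big_ord0.
  have e (j k : 'I_2) := normc_mx_of_row_le (v - w) j k.
  have := e ord0 ord0; have := e ord0 (lift ord0 ord0).
  have := e (lift ord0 ord0) ord0.
  by have := e (lift ord0 ord0) (lift ord0 ord0); lra.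
exists (c * 8); first by rewrite mulr_gt0.
by move=> v w; rewrite ler_norml lerNl opprB half distrC half.
Qed.

(** The norm attains a positive minimum on the compact unit sphere of the
    coordinate space. *)
Lemma is_norm_lower : exists2 c : R, 0 < c &
  forall (A : 'M[R[i]]_2) j k, normc (A j k) <= c * N A.
Proof.
have [L L0 HL] := is_norm_row_lipschitz.
pose F (v : 'rV[R]_n8) := N (mx_of_row v).
have cF : continuous F.
  move=> v; apply/(@cvgrPdist_lt _ _ _ (nbhs v) (nbhs_filter v)) => e e0.
  apply/nbhs_ballP; exists (e / L) => /=; first by rewrite divr_gt0.
  move=> w; rewrite -ball_normE /= => vw.
  by apply: le_lt_trans (HL _ _) _; rewrite mulrC -ltr_pdivlMr.
pose S := [set v : 'rV[R]_n8 | `|v| = 1].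
have cS : compact S.
  apply: bounded_closed_compact.
    by exists 1; split; [exact: num_real|move=> M M1 v /= ->; exact: ltW].
  rewrite (_ : S = (fun v => `|v|) @^-1` [set 1])//.
  apply: preimage_closed; last exact: closed_eq.
  by move=> v _; exact: norm_continuous.
have l0 : 'I_n8 by exact: (enum_rank (ord0, ord0, false)).
pose one : 'rV[R]_n8 := const_mx 1.
have one0 : 0 < `|one|.
  rewrite normr_gt0; apply/eqP => /rowP /(_ l0); rewrite !mxE => /eqP.
  by rewrite oner_eq0.
have normalize (v : 'rV[R]_n8) : 0 < `|v| -> S (`|v|^-1 *: v).
  move=> v0; rewrite /S/= normrZ ger0_norm ?invr_ge0//.
  by rewrite mulVf// gt_eqF.
have S0 : S !=set0 by exists (`|one|^-1 *: one); exact: normalize.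
have [v0 Sv0 minF] := compact_EVT_min S0 cS (continuous_subspaceT cF).
have m0 : 0 < F v0.
  rewrite lt_neqAle norm_ge0// andbT eq_sym; apply/eqP => /(norm_eq0 hN).
  move=> /mx_of_row_eq0 v00; move: (set_mem Sv0); rewrite /S/= v00 normr0.
  by move/eqP; rewrite eq_sym oner_eq0.
exists (2 / F v0); first by rewrite divr_gt0.
move=> A j k; rewrite -(row_of_mxK A); set v := row_of_mx A.
apply: le_trans (normc_mx_of_row_le v j k) _.
rewrite -mulrA ler_pM2l// mulrC ler_pdivlMr//.
have [->|v_neq0] := eqVneq v 0; first by rewrite normr0 mul0r norm_ge0.
have nv0 : 0 < `|v| by rewrite normr_gt0.
have := minF _ (mem_set (normalize v nv0)).
rewrite {2}/F mx_of_rowZ (norm_scale hN) normc_real ger0_norm ?invr_ge0//.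
by rewrite mulrC ler_pdivlMr// mulrC.
Qed.

End FiniteDimensionalNorm.

(** * Solutions of the Dirac system *)

Section DiracSolutions.
Context {R : realType}.
Local Notation mu := (@lebesgue_measure R).
Implicit Types (Q Y Z : R -> 'M[R[i]]_2) (lam : R[i]).

(** The Dirac system solved for the derivative, entry by entry; j and l are the
    two distinct row indices, so that (Q Y)_jk = Q_jl Y_lk. *)
Definition dirac_solution (b1 b2 : R) Q lam Y : Prop :=
  Y 0 = 1%:M /\ forall j l k, j != l ->
    cac_deriv (fun x => Y x j k) (fun x => 'i%C * (bcoef b1 b2 j)%:C *
      (lam * Y x j k - Q x j l * Y x l k)).

Lemma mulmx_offdiag (A B : 'M[R[i]]_2) (j l k : 'I_2) : j != l -> A j j = 0 ->
  (A *m B) j k = A j l * B l k.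
Proof.
move=> jl Ajj; rewrite mxE (bigD1 l)//= big1 ?addr0// => t tl.
have -> : t = j; last by rewrite Ajj mul0r.
by apply/val_inj; move: j l t jl tl {Ajj} => [[|[|?]]?] [[|[|?]]?] [[|[|?]]?].
Qed.

(** Multiplying the differential equation by B clears the inverse of B. *)
Lemma fundamental_matrix_dirac_solution (b1 b2 : R) Q lam Y :
  b1 != 0 -> b2 != 0 -> potential Q -> fundamental_matrix b1 b2 Q lam Y ->
  dirac_solution b1 b2 Q lam Y.
Proof.
move=> b1n0 b2n0 [Qd _] [Y0 acY aeY]; split=> // j l k jl.
apply: (cac_deriv_ae (acY j k)); apply: ae_imply aeY => x H x01.
have {H} [dY eqY] := H x01; split; first exact: dY.
have Bu : Bmx b1 b2 \in unitmx.
  rewrite unitmxE det_diag unitfE; apply/prodf_neq0 => i _; rewrite mxE /bcoef.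
  by rewrite eq_complex/= eqxx andbT; case: ifP.
have {eqY} := congr1 (fun A => (Bmx b1 b2 *m A) j k) eqY.
rewrite mulmxDr -!scalemxAr mulKVmx// !mul_diag_mx !mxE.
rewrite -[X in _ + _ * X = _](_ : (Q x *m Y x) j k = _); last by rewrite mxE.
rewrite (mulmx_offdiag _ _ jl) ?Qd//.
set D := cderive1 _ _; move: ((bcoef b1 b2 j)%:C) => c eqD.
have ii : 'i%C * 'i%C = -1 :> R[i] by rewrite -expr2 sqr_i.
have -> : D = 'i%C * (- 'i%C * D + c * (Q x j l * Y x l k)) -
    'i%C * c * (Q x j l * Y x l k).
  by move: ('i%C : R[i]) ii {eqD} => i ii; ring: ii.
by rewrite eqD; ring.
Qed.

Lemma Phi0_dirac_solution (b1 b2 : R) lam :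
  dirac_solution b1 b2 (fun=> 0) lam (Phi0 b1 b2 ^~ lam).
Proof.
split.
  by apply/matrixP => j k; rewrite !mxE mulr0 cexp0.
move=> j l k jl; have dexp := cac_deriv_cexp ('i%C * (bcoef b1 b2 j)%:C * lam).
have [<-|jk] := eqVneq j k.
  by apply: cac_deriv_eq dexp => x _; rewrite !mxE eqxx mulr1n// mul0r subr0 mulrA.
apply: cac_deriv_eq (cac_deriv_cst 0) => x _; rewrite !mxE (negPf jk) mulr0n//.
by rewrite mul0r mulr0 subr0 mulr0.
Qed.

(** The oscillatory integrals are bounded on [0, 1], being absolutely continuous
    in their endpoint; hence the supremum dominates them. *)
Lemma supfourier_ge (b1 b2 : R) j l (q : R -> R[i]) lam (x s : R) :
  cintegrable `[0, 1]%classic q -> 0 <= s <= x -> x <= 1 ->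
  normc (cintegral `[0, s]%classic (fun t => q t *
    cexp ('i%C * (bcoef b1 b2 l - bcoef b1 b2 j)%:C * lam * t%:C)))
  <= supfourier b1 b2 j l q lam x.
Proof.
move=> iq sx x1.
have [M HM] := cac_bounded (cac_deriv_cintegral (cintegrable_cexp
  ('i%C * (bcoef b1 b2 l - bcoef b1 b2 j)%:C * lam) iq)).
apply: ub_le_sup.
  by exists M => _ [t + <-]; rewrite /= in_itv/= => tx; apply: HM; lra.
by exists s => //=; rewrite in_itv.
Qed.

Lemma supfourier_ge0 (b1 b2 : R) j l (q : R -> R[i]) lam (x : R) :
  0 <= supfourier b1 b2 j l q lam x.
Proof.
rewrite /supfourier; set A := (X in sup X).
have [[[a Aa] ubA]|nsup] := pselect (has_sup A); last by rewrite sup_out.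
apply: le_trans (ub_le_sup ubA Aa).
by case: Aa => t _ <-; exact: normc_ge0.
Qed.

Lemma big_offdiag (F : 'I_2 * 'I_2 -> R) :
  \sum_(p : 'I_2 * 'I_2 | p.1 != p.2) F p = F (0, 1) + F (1, 0).
Proof.
rewrite big_mkcond/=.
transitivity (\sum_i \sum_j if i != j then F (i, j) else 0).
  by rewrite pair_bigA/=; apply: eq_bigr => -[].
rewrite !big_ord_recl !big_ord0/= !addr0 add0r.
congr (F _ + F _); congr (_, _); exact: val_inj.
Qed.

End DiracSolutions.

(** * Comparison of two fundamental matrices *)

Section DiracComparison.
Context {R : realType}.
Local Notation mu := (@lebesgue_measure R).

(** The integral of a nonnegative function is the supremum of the integrals of
    the simple functions below it, hence monotone.  This compares N (Q x) with
    the entries of Q. *)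
Lemma ge0_integral_monotone d (T : measurableType d)
    (nu : {measure set T -> \bar R}) (D : set T) (f g : T -> \bar R) :
  (forall x, D x -> (0 <= f x)%E) -> (forall x, D x -> (f x <= g x)%E) ->
  (\int[nu]_(x in D) f x <= \int[nu]_(x in D) g x)%E.
Proof.
move=> f0 fg.
have g0 x : D x -> (0 <= g x)%E by move=> Dx; exact: le_trans (f0 x Dx) (fg x Dx).
rewrite ge0_integralE// ge0_integralE//; apply: ge_ereal_sup => _ [h/= hf <-].
apply: ereal_sup_ubound; exists h => //= x; apply: le_trans (hf x) _.
rewrite !patchE; case: ifPn => // /set_mem; exact: fg.
Qed.

Definition l1norm (z : R[i]) : R := `|Re z| + `|Im z|.

Lemma normc_le_l1norm z : normc z <= l1norm z.
Proof.
apply: normc_le_sqr; first by rewrite addr_ge0.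
rewrite /abs2 -[_ ^+ 2 in leLHS]real_normK ?num_real//.
rewrite -[X in _ + X <= _]real_normK ?num_real// /l1norm.
have := normr_ge0 (Re z); have := normr_ge0 (Im z); nra.
Qed.

Lemma l1norm_le_normc z : l1norm z <= 2 * normc z.
Proof.
by have := normc_ge_absRe z; have := normc_ge_absIm z; rewrite /l1norm; lra.
Qed.

Lemma integrable_l1norm (q : R -> R[i]) : cintegrable `[0, 1]%classic q ->
  mu.-integrable `[0, 1] (EFin \o (fun x => l1norm (q x))).
Proof.
move=> [rq iq].
have [nr ni] := (integrable_norm rq, integrable_norm iq).
by apply: eq_integrable (integrableD _ nr ni).
Qed.

Definition offdiag (Q : R -> 'M[R[i]]_2) (x : R) : R :=
  l1norm (Q x 0 1) + l1norm (Q x 1 0).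

Lemma integrable_offdiag Q : potential Q ->
  mu.-integrable `[0, 1] (EFin \o offdiag Q).
Proof.
move=> [_ iQ].
have [i01 i10] := (integrable_l1norm (iQ 0 1), integrable_l1norm (iQ 1 0)).
by apply: eq_integrable (integrableD _ i01 i10).
Qed.

Lemma sum_I2 (V : nmodType) (F : 'I_2 -> V) : \sum_j F j = F 0 + F 1.
Proof.
rewrite !big_ord_recl big_ord0/= addr0; congr (F _ + F _); exact: val_inj.
Qed.

(** Up to constants the function N (Q x) lies between offdiag Q x / (4 c) and
    an integrable function.  The upper bound makes its integral finite, so that
    the lower bound passes to the real-valued integral. *)
Lemma integral_offdiag_le (N : 'M[R[i]]_2 -> R) (hN : is_norm N) (c : R) Q :
  0 < c -> (forall (A : 'M[R[i]]_2) j k, normc (A j k) <= c * N A) ->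
  potential Q ->
  \int[mu]_(x in `[0, 1]) offdiag Q x <= 4 * c * L1norm N Q.
Proof.
move=> c0 Hc pQ; have ioff := integrable_offdiag pQ.
have [cu cu0 Hu] := is_norm_upper hN.
have c40 : 0 < 4 * c by rewrite mulr_gt0.
have iZ (a : R) : mu.-integrable `[0, 1] (EFin \o (fun x => a * offdiag Q x)).
  by apply: eq_integrable (integrableZl _ a ioff) => //.
have off0 x : 0 <= offdiag Q x by rewrite !addr_ge0.
rewrite mulrC -ler_pdivrMr// mulrC -RintegralZl//.
rewrite /L1norm /Rintegral; apply: fine_le.
- exact: integrable_fin_num (iZ _).
- rewrite ge0_fin_numE; last first.
    by apply: integral_ge0 => x _; rewrite lee_fin norm_ge0.
  have /integrable_fin_num := iZ cu.
  move=> /(_ (measurable_itv _)); rewrite ge0_fin_numE; last first.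
    by apply: integral_ge0 => x _; rewrite lee_fin mulr_ge0// ltW.
  apply: le_lt_trans; apply: ge0_integral_monotone => x; rewrite /= in_itv/= => x01.
    by rewrite lee_fin norm_ge0.
  rewrite lee_fin; apply: le_trans (Hu _) _; rewrite ler_wpM2l ?(ltW cu0)//.
  rewrite !sum_I2 !pQ.1// !normc0 add0r addr0.
  by apply: lerD; exact: normc_le_l1norm.
- apply: ge0_integral_monotone => x; rewrite /= in_itv/= => x01.
    by rewrite lee_fin mulr_ge0// invr_ge0 ltW.
  rewrite lee_fin mulrC ler_pdivrMr// /offdiag.
  have := l1norm_le_normc (Q x 0 1); have := l1norm_le_normc (Q x 1 0).
  by have := Hc (Q x) 0 1; have := Hc (Q x) 1 0; lra.
Qed.

(** Both columns of the difference are instances of [column_comparison] with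
    b = b2 - b1, which exceeds |b1| and |b2| since these have opposite signs. *)
Lemma dirac_comparison (N : 'M[R[i]]_2 -> R) (hN : is_norm N)
    (b1 b2 : R) (hb1 : b1 < 0) (hb2 : 0 < b2) (r : R) :
  0 < r -> exists2 C : R, 0 < C & forall Q Qt, U1r N r Q -> U1r N r Qt ->
    forall lam Y Z,
    dirac_solution b1 b2 Q lam Y -> dirac_solution b1 b2 Qt lam Z ->
    forall x : R, 0 <= x <= 1 ->
      N (Y x - Z x) <= C * expR (2 * (b2 - b1) * `|Im lam| * x) *
        \sum_(p : 'I_2 * 'I_2 | p.1 != p.2)
          supfourier b1 b2 p.1 p.2 (fun t => Q t p.1 p.2 - Qt t p.1 p.2) lam x.
Proof.
move=> r0; have [cl cl0 Hl] := is_norm_lower hN.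
have [cu cu0 Hu] := is_norm_upper hN.
pose b := b2 - b1; pose rho := 8 * cl * r.
pose K := expR (b * rho) * (expR ((b + 2 * b ^+ 2) * rho) + b).
have b0 : 0 < b by rewrite /b; lra.
have K0 : 0 < K by rewrite mulr_gt0 ?expR_gt0// addr_gt0 ?expR_gt0.
exists (4 * cu * K); first by apply: mulr_gt0 => //; apply: mulr_gt0.
move=> Q Qt [pQ NQ] [pQt NQt] lam Y Z [Y0 dY] [Z0 dZ] X X01.
rewrite big_offdiag/=; set S := supfourier _ _ _ _ _ _ _ + _.
pose P j l x := cintegral `[0, x]%classic (fun t => (Q t j l - Qt t j l) *
  cexp ('i%C * (bcoef b1 b2 l - bcoef b1 b2 j)%:C * lam * t%:C)).
have iP j l : cintegrable `[0, 1]%classic (fun t => Q t j l - Qt t j l).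
  by apply: cintegrableB; [exact: pQ.2|exact: pQt.2].
have dP j l := cac_deriv_cintegral (cintegrable_cexp
  ('i%C * (bcoef b1 b2 l - bcoef b1 b2 j)%:C * lam) (iP j l)).
have P0 j l : P j l 0 = 0.
  by rewrite /P /cintegral set_itv1 !Rintegral_set1.
have PS (x : R) : 0 <= x <= X -> normc (P 0 1 x) + normc (P 1 0 x) <= S.
  by move=> xX; apply: lerD; apply: supfourier_ge => //; lra.
have bb j : `|bcoef b1 b2 j| <= b.
  by rewrite /bcoef /b ler_norml; case: ifP => _; lra.
have bb01 : `|bcoef b1 b2 0 - bcoef b1 b2 1| <= b.
  by rewrite /bcoef/= ler_norml /b; lra.
pose k x := offdiag Q x + offdiag Qt x.
have ik : mu.-integrable `[0, 1] (EFin \o k).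
  have [i1 i2] := (integrable_offdiag pQ, integrable_offdiag pQt).
  by apply: eq_integrable (integrableD _ i1 i2).
have qk (x : R) : 0 <= x <= 1 -> normc (Q x 0 1) + normc (Q x 1 0) +
    (normc (Qt x 0 1) + normc (Qt x 1 0)) <= k x.
  by move=> _; rewrite !lerD// normc_le_l1norm.
have krho : \int[mu]_(t in `[0, 1]) k t <= rho.
  rewrite RintegralD//; [|exact: integrable_offdiag|exact: integrable_offdiag].
  have -> : rho = 4 * cl * r + 4 * cl * r by rewrite /rho; ring.
  by apply: lerD; (apply: le_trans (integral_offdiag_le hN cl0 Hl _) _ => //;
    rewrite ler_wpM2l ?mulr_ge0// ltW).
have ent j l : normc ((Y X - Z X) j l) <= expR (2 * (b * `|Im lam|) * X) * S * K.
  have [] := column_comparison X01 (bb 0) (bb 1) bb01 ik qk krho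
    (dY 0 1 l isT) (dY 1 0 l isT) (dZ 0 1 l isT) (dZ 1 0 l isT) _ _ _
    (dP 0 1) (dP 1 0) (P0 0 1) (P0 1 0) PS.
  - by rewrite Y0 Z0.
  - by rewrite Y0 Z0.
  - rewrite Z0 !mxE /abs2.
    by case: l => [[|[|//]]] ?; rewrite /= !expr0n/= expr1n !addr0 ?add0r.
  - move=> H0 H1; rewrite !mxE.
    have [->|->] : j = 0 \/ j = 1; last exact: H1; last exact: H0.
    by case: j => [[|[|//]]] ?; [left|right]; exact: val_inj.
apply: le_trans (Hu _) _; rewrite !sum_I2.
have -> : 4 * cu * K * expR (2 * (b2 - b1) * `|Im lam| * X) * S =
  cu * (4 * (expR (2 * (b * `|Im lam|) * X) * S * K)).
  by rewrite (_ : 2 * (b2 - b1) * `|Im lam| * X = 2 * (b * `|Im lam|) * X);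
    [ring|rewrite /b; ring].
rewrite ler_wpM2l ?(ltW cu0)//.
by have := ent 0 0; have := ent 0 1; have := ent 1 0; have := ent 1 1; lra.
Qed.

End DiracComparison.

End ComparisonOfSolutions.

Theorem theorem7p9 (R : realType) (N : 'M[R[i]]_2 -> R) (hN : is_norm N)
    (b1 b2 : R) (hb1 : b1 < 0) (hb2 : 0 < b2) (r : R) (hr : 0 < r) :
  exists C : R,
    [/\ 0 < C,
      forall Q Qt : R -> 'M[R[i]]_2, U1r N r Q -> U1r N r Qt ->
      forall Phi Phit : R -> R[i] -> 'M[R[i]]_2,
      (forall lambda, fundamental_matrix b1 b2 Q lambda (Phi^~ lambda)) ->
      (forall lambda, fundamental_matrix b1 b2 Qt lambda (Phit^~ lambda)) ->
      forall (x : R) (lambda : R[i]), 0 <= x <= 1 ->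
        N (Phi x lambda - Phit x lambda) <=
          C * expR (2 * (b2 - b1) * `|complex.Im lambda| * x) *
          \sum_(p : 'I_2 * 'I_2 | p.1 != p.2)
            (supfourier b1 b2 p.1 p.2
               (fun t => Q t p.1 p.2 - Qt t p.1 p.2) lambda x
             + L1norm N (fun t => Q t - Qt t)
               * supfourier b1 b2 p.1 p.2 (fun t => Qt t p.1 p.2) lambda x)
    & forall Q : R -> 'M[R[i]]_2, U1r N r Q ->
      forall Phi : R -> R[i] -> 'M[R[i]]_2,
      (forall lambda, fundamental_matrix b1 b2 Q lambda (Phi^~ lambda)) ->
      forall (x : R) (lambda : R[i]), 0 <= x <= 1 ->
        N (Phi x lambda - Phi0 b1 b2 x lambda) <=
          C * expR (2 * (b2 - b1) * `|complex.Im lambda| * x) *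
          \sum_(p : 'I_2 * 'I_2 | p.1 != p.2)
            supfourier b1 b2 p.1 p.2 (fun t => Q t p.1 p.2) lambda x].
Proof.
have [C C0 HC] := dirac_comparison hN hb1 hb2 hr.
have b1n0 : b1 != 0 by rewrite lt_eqF.
have b2n0 : b2 != 0 by rewrite gt_eqF.
exists C; split => //.
- move=> Q Qt hQ hQt Phi Phit hPhi hPhit x lambda x01.
  have solQ := fundamental_matrix_dirac_solution b1n0 b2n0 hQ.1 (hPhi lambda).
  have solQt := fundamental_matrix_dirac_solution b1n0 b2n0 hQt.1 (hPhit lambda).
  apply: le_trans (HC _ _ hQ hQt _ _ _ solQ solQt _ x01) _.
  rewrite ler_wpM2l ?mulr_ge0 ?expR_ge0 ?(ltW C0)//; apply: ler_sum => p _.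
  rewrite lerDl mulr_ge0 ?supfourier_ge0//.
  by apply: Rintegral_ge0 => t _; exact: norm_ge0.
- move=> Q hQ Phi hPhi x lambda x01.
  have solQ := fundamental_matrix_dirac_solution b1n0 b2n0 hQ.1 (hPhi lambda).
  have h0 : U1r N r (fun=> 0).
    split; last first.
      by rewrite /L1norm is_norm0// Rintegral_cst// mul0r ltW.
    split=> [y _ j|j k]; first by rewrite mxE.
    by split; apply: eq_integrable (integrable0 _ _) => // y _; rewrite mxE.
  have -> : \sum_(p : 'I_2 * 'I_2 | p.1 != p.2)
      supfourier b1 b2 p.1 p.2 (fun t => Q t p.1 p.2) lambda x =
    \sum_(p : 'I_2 * 'I_2 | p.1 != p.2)
      supfourier b1 b2 p.1 p.2
        (fun t => Q t p.1 p.2 - (0 : 'M[R[i]]_2) p.1 p.2) lambda x.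
    apply: eq_bigr => p _.
    by under [in RHS]eq_fun do rewrite mxE subr0.
  exact: (HC _ _ hQ h0 _ _ _ solQ (Phi0_dirac_solution b1 b2 lambda) _ x01).
Qed.
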